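(* Any derived set of a regular $s$-interval exchange set is a regular $s$-interval exchange set. That is: let $T$ be a regular $s$-interval exchange transformation on the alphabet $A$, let $F=F(T)$, let $w\in F$ and let $f:B^*\to A^*$ be a coding morphism for $\mathcal R_F(w)$. Then there exists a regular $s$-interval exchange transformation $T'$ on the alphabet $B$ such that $\mathcal D_f(F)=F(T')$.
   Context: An $s$-interval exchange transformation $T$ on $[\ell,r[$ over a finite alphabet $A$ of cardinality $s$ with two total orders $<_1,<_2$ is given by a partition $(I_a)_{a\in A}$ of $[\ell,r[$ into semi-intervals $I_a=[\gamma_a,\mu_a[$ (sets $[\alpha,\beta[=\{z:\alpha\le z<\beta\}$) of lengths $\lambda_a>0$ placed left to right in the order $<_1$; with $\nu_a=\ell+\sum_{b\le_2a}\lambda_b$, $T(z)=z+\nu_a-\mu_a$ on $I_a$. Writing $A=\{a_1<_1\cdots<_1a_s\}$, $T$ is regular if the orbits under $T$ of $\gamma_{a_2},\dots,\gamma_{a_s}$ are infinite and pairwise disjoint; regular implies minimal (all orbits dense). Natural coding: $\Sigma_T(z)=c_0c_1\cdots$ with $c_n=a$ iff $T^n(z)\in I_a$. For minimal $T$, $F(T)$ denotes the set of finite factors of $\Sigma_T(z)$ (independent of $z$); a regular $s$-interval exchange set is a set $F(T)$ with $T$ a regular $s$-interval exchange transformation. For a set of words $F$ and $w\in F$: $\Gamma_F(w)=\{x\in F:wx\in F\cap A^+w\}$, $\mathcal R_F(w)=\Gamma_F(w)\setminus\Gamma_F(w)A^+$ (first return words, $A^+$ the nonempty words). A coding morphism for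 $\mathcal R_F(w)$ is a monoid morphism $f:B^*\to A^*$ mapping the alphabet $B$ bijectively onto $\mathcal R_F(w)$. The derived set of $F$ with respect to $f$ is $\mathcal D_f(F)=f^{-1}(w^{-1}F)$, where $w^{-1}F=\{v\in A^*:wv\in F\}$. *)

(* Defs.v *)
From mathcomp Require Import all_boot all_order all_algebra.
From mathcomp Require Import boolp classical_sets functions cardinality reals.
Set Implicit Arguments.
Unset Strict Implicit.
Unset Printing Implicit Defensive.
Import Order.TTheory GRing.Theory Num.Theory.
Local Open Scope classical_set_scope.
Local Open Scope ring_scope.

Section Words.
Variables A B : finType.

Definition nonempty_words : set (seq A) := [set u | u != [::]].

Definition cat_set (X Y : set (seq A)) : set (seq A) :=
  [set x ++ y | x in X & y in Y].

Definition left_quotient (w : seq A) (F : set (seq A)) : set (seq A) :=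
  [set v | F (w ++ v)].

Definition right_returns (F : set (seq A)) (w : seq A) : set (seq A) :=
  [set x | F x /\ (F `&` cat_set nonempty_words [set w]) (w ++ x)].

Definition first_returns (F : set (seq A)) (w : seq A) : set (seq A) :=
  right_returns F w `\` cat_set (right_returns F w) nonempty_words.

Definition word_morphism (f : seq B -> seq A) :=
  f [::] = [::] /\ {morph f : u v / u ++ v}.

Definition coding_morphism (f : seq B -> seq A) (X : set (seq A)) :=
  word_morphism f /\ set_bij [set: B] X (fun b => f [:: b]).

Definition derived_set (f : seq B -> seq A) (F : set (seq A)) (w : seq A) :
    set (seq B) :=
  f @^-1` left_quotient w F.

(* Infinite words are valued in [option A], [None] standing for "no letter". *)
Definition factors (c : nat -> option A) : set (seq A) :=
  [set u | exists n, map Some u = mkseq (fun k => c (n + k)%N) (size u)].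

End Words.

Definition total_order (A : finType) (le : rel A) :=
  [/\ total le, antisymmetric le & transitive le].

(* The semi-intervals are laid side by side from [iet_left], so the partition
   is determined by the lengths and the first order. *)
Record iet (R : realType) (A : finType) := IET {
  iet_left : R;
  iet_len : A -> R;
  iet_le1 : rel A;
  iet_le2 : rel A;
  iet_len_gt0 : forall a, 0 < iet_len a;
  iet_le1_order : total_order iet_le1;
  iet_le2_order : total_order iet_le2
}.

Section IntervalExchange.
Variables (R : realType) (A : finType) (T : iet R A).

Definition iet_lt1 : rel A := [rel a b | (a != b) && iet_le1 T a b].

Definition iet_right : R := iet_left T + \sum_a iet_len T a.

Definition iet_dom : interval R := `[iet_left T, iet_right[.

Definition iet_gamma (a : A) : R :=
  iet_left T + \sum_(b | iet_lt1 b a) iet_len T b.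

Definition iet_mu (a : A) : R :=
  iet_left T + \sum_(b | iet_le1 T b a) iet_len T b.

Definition iet_nu (a : A) : R :=
  iet_left T + \sum_(b | iet_le2 T b a) iet_len T b.

Definition iet_itv (a : A) : interval R := `[iet_gamma a, iet_mu a[.

Definition iet_letter (z : R) : option A := [pick a | z \in iet_itv a].

(* Outside [iet_dom] the transformation is the identity (junk value). *)
Definition iet_map (z : R) : R :=
  if iet_letter z is Some a then z + iet_nu a - iet_mu a else z.

(* [iet_map] is a bijection of [iet_dom], so this is the two-sided orbit
   {T^n(z) : n in Z}. *)
Definition iet_orbit (z : R) : set R :=
  [set y | y \in iet_dom /\
     exists n, y = iter n iet_map z \/ z = iter n iet_map y].

(* The letters a_2, ..., a_s are those that are not minimal for the first
   order. *)
Definition iet_nonfirst : set A := [set a | exists b, iet_lt1 b a].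

Definition iet_regular :=
  (forall a, iet_nonfirst a -> infinite_set (iet_orbit (iet_gamma a))) /\
  (forall a b, iet_nonfirst a -> iet_nonfirst b -> a != b ->
     iet_orbit (iet_gamma a) `&` iet_orbit (iet_gamma b) = set0).

Definition natural_coding (z : R) (n : nat) : option A :=
  iet_letter (iter n iet_map z).

(* The set F(T), computed from the base point [z]. *)
Definition iet_language (z : R) : set (seq A) := factors (natural_coding z).

End IntervalExchange.

(* Main.v *)
Require Import Defs.
From mathcomp Require Import all_boot all_order all_algebra.
From mathcomp Require Import boolp classical_sets functions cardinality reals.
From mathcomp Require Import zify lra.
Set Implicit Arguments.
Unset Strict Implicit.
Unset Printing Implicit Defensive.
Import Order.TTheory GRing.Theory Num.Theory.
Local Open Scope classical_set_scope.
Local Open Scope ring_scope.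

(* The points whose coding starts with w form a semi-interval J, and the first
   return map of T to J is again an interval exchange: the first return words x
   label the pieces {z | the coding of z starts with w x}, on which the return
   map is the translation T^|x|.  Following the interior endpoints of the pieces
   under T, each one meets exactly one separation point gamma_a between the
   times |w| and |w| + |x| - 1, and every gamma_a is met, so there are s pieces
   and their endpoints inherit the regularity of T.  That the language does not
   depend on the base point, for T and for the return map, is Keane's theorem
   that regular interval exchanges are minimal. *)

(** * Families of disjoint semi-intervals *)

(** Two translations make the argument possible. The definitions give positions as sums of lengths,
    and [tile_pos] identifies these sums with actual endpoints. They also read F(T) from one base
    point, and [languageP] replaces it by the set of words with a nonempty cylinder. The delicate
    point is the left end l of the domain. It is not a separation point, yet orbits starting there
    must not run into one: otherwise the leftmost point of J could absorb some gamma_a that no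
    interior endpoint meets. Regularity forbids this because l is itself the image of a separation
    point. Minimality is proved for injective piecewise translations without measure theory:
    recurrence comes from packing disjoint intervals of equal length. A one-letter alphabet has no
    separation point and is treated apart. *)

Section Tiling.
Variables (R : realType) (I : finType) (p len : I -> R).
Hypothesis len_gt0 : forall i, 0 < len i.
Hypothesis apart : forall i j, i != j -> p i <= p j -> p i + len i <= p j.

(** Induction on the number of intervals: once the rightmost one is removed, [apart] confines the
    others to the left of it. *)
Lemma packing (X : {set I}) (a b : R) : a <= b ->
  (forall i, i \in X -> a <= p i /\ p i + len i <= b) ->
  \sum_(i in X) len i <= b - a.
Proof.
move: {2}#|X| (erefl #|X|) => n; elim: n X b => [|n IHn] X b cardX leab Xab.
  by rewrite (cards0_eq cardX) big_set0; lra.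
have /card_gt0P[i0 i0X] : (0 < #|X|)%N by rewrite cardX.
case: (@arg_maxP _ _ _ i0 [in X] p i0X) => i;
  change ([in X] i) with (i \in X) => iX imax.
rewrite (big_setD1 i) //=.
have [ai ib] := Xab _ iX.
have cardXi : #|X :\ i| = n by have := cardsD1 i X;
  rewrite iX cardX add1n => -[].
suff : \sum_(j in X :\ i) len j <= p i - a by have := len_gt0 i; lra.
apply: IHn => // j; rewrite !inE => /andP[ji jX]; have [aj jb] := Xab _ jX;
  split=> //.
by apply: apart => //; exact: imax.
Qed.

Lemma covering (X : {set I}) (a b : R) :
  (forall z, a <= z < b -> exists2 i, i \in X & p i <= z < p i + len i) ->
  b - a <= \sum_(i in X) len i.
Proof.
have sum_ge0 (Y : {set I}) : 0 <= \sum_(i in Y) len i.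
  by apply: sumr_ge0 => i _; apply: ltW.
move: {2}#|X| (erefl #|X|) => n; elim: n X b => [|n IHn] X b cardX Xab.
  rewrite leNgt; apply/negP => lt_ab.
  have [|i] := Xab a; first by move: lt_ab;
    rewrite (cards0_eq cardX) big_set0; lra.
  by rewrite (cards0_eq cardX) inE.
have /card_gt0P[i0 i0X] : (0 < #|X|)%N by rewrite cardX.
case: (@arg_maxP _ _ _ i0 [in X] p i0X) => i;
  change ([in X] i) with (i \in X) => iX imax.
rewrite (big_setD1 i) //=.
have cardXi : #|X :\ i| = n by have := cardsD1 i X;
  rewrite iX cardX add1n => -[].
(* The rightmost interval cannot stop before [b]: an interval [j] covering its end would start no
   later than it, hence end before that point. *)
have leib : p i < b -> a <= p i + len i -> b <= p i + len i.
  move=> ib ai; rewrite leNgt; apply/negP => lt_ib.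
  have [|j jX jP] := Xab (p i + len i); first lra.
  have [ji|ji] := eqVneq j i; first by move: jP; rewrite ji; lra.
  by have := apart ji (imax _ jX); have := len_gt0 i; lra.
have := sum_ge0 (X :\ i); have := len_gt0 i => leni sumi.
have cov c : (c <= p i) || (p i + len i <= a) -> c <= b ->
  c - a <= \sum_(j in X :\ i) len j.
  move=> ci cb; apply: IHn => // z az.
  have [|j jX jP] := Xab z; first lra.
  by exists j => //; rewrite !inE jX andbT; apply: contraTneq jP => ->; lra.
have [bi|ib] := leP b (p i).
  by have := cov b; rewrite bi => /(_ isT (lexx _)); lra.
have [ai|ai] := leP a (p i + len i).
  by have := cov (p i); rewrite lexx => /(_ isT (ltW ib));
    have := leib ib ai; lra.
by have := cov b; rewrite (ltW ai) orbT => /(_ isT (lexx _)); lra.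
Qed.

Lemma packing_pred (P : pred I) (a b : R) : a <= b ->
  (forall i, P i -> a <= p i /\ p i + len i <= b) ->
  \sum_(i | P i) len i <= b - a.
Proof.
move=> leab Pab; rewrite (eq_bigl [in [set i | P i]%SET]).
  by apply: packing => // i; rewrite inE => /Pab.
by move=> i; rewrite inE.
Qed.

Variables a b : R.
Hypothesis le_ab : a <= b.
Hypothesis inside : forall i, a <= p i /\ p i + len i <= b.

Lemma tile_sum :
  (forall z, a <= z < b -> exists i, p i <= z < p i + len i) ->
  \sum_i len i = b - a.
Proof.
move=> cov; apply/eqP; rewrite eq_le packing_pred //=.
rewrite (eq_bigl [in [set: I]%SET]) => [|i]; last by rewrite inE.
by apply: covering => // z /cov[i]; exists i; rewrite ?inE.
Qed.

Hypothesis sum_len : \sum_i len i = b - a.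

(** The intervals starting before [p i] have total length at most [p i - a], the others at most
    [b - p i]. Together they fill [b - a], so both bounds are attained. *)
Lemma tile_pos i : p i = a + \sum_(j | p j < p i) len j.
Proof.
have [ai ib] := inside i; have leni := len_gt0 i.
have lo : \sum_(j | p j < p i) len j <= p i - a.
  apply: packing_pred => // j ji; split; first by case: (inside j).
  by apply: apart; [apply: contraTneq ji => ->; rewrite ltxx|exact: ltW].
have hi : \sum_(j | ~~ (p j < p i)) len j <= b - p i.
  apply: packing_pred => [|j]; first lra.
  by rewrite -leNgt; case: (inside j).
by have := sum_len; rewrite (bigID (fun j => p j < p i)) /=; lra.
Qed.

(** An uncovered [z] would lose length: the intervals starting up to [z] also end by [z], while
    their total must reach the next left endpoint, or [b] if there is none. *)
Lemma tile_cover z : a <= z < b -> exists i, p i <= z < p i + len i.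
Proof.
move=> zab; apply: contrapT => nz.
have nzi i : p i <= z -> p i + len i <= z.
  by move=> iz; rewrite leNgt; apply/negP => zi; apply: nz; exists i;
    apply/andP.
have lo : \sum_(j | p j <= z) len j <= z - a.
  apply: packing_pred => [|j /nzi]; first lra.
  by case: (inside j).
have [i0 zi0|nz'] := pickP [pred i | z < p i]; last first.
  have := sum_len; rewrite (eq_bigl (fun j => p j <= z)); first by lra.
  by move=> j; rewrite leNgt; have /= -> := nz' j.
case: (@arg_minP _ _ _ i0 [pred i | z < p i] p zi0) => i /= zi imin.
have := tile_pos i; rewrite (eq_bigl (fun j => p j <= z)); first by lra.
move=> j /=; case: (leP (p j) z) => jz; first by apply/idP; lra.
by apply/negbTE; rewrite -leNgt; exact: imin.
Qed.

End Tiling.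

(** * Minimality of piecewise translations *)

Lemma seq_max_le (R : realDomainType) (s : seq R) (a z : R) :
  a \in s -> a <= z ->
  exists x, [/\ x \in s, x <= z & forall p, p \in s -> p <= z -> p <= x].
Proof.
rewrite -index_mem => ia az.
have [|i iz imax] := @arg_maxP _ _ _ (Ordinal ia) [pred i : 'I_(size s) |
  s`_i <= z]
  (fun i : 'I_(size s) => s`_i); first by rewrite /= nth_index -?index_mem.
exists s`_i; split=> [||p]; rewrite ?mem_nth // -index_mem => ip pz.
have /= := imax (Ordinal ip); rewrite nth_index -?index_mem //; exact.
Qed.

Lemma seq_min_gt (R : realDomainType) (s : seq R) (a z : R) :
  a \in s -> z < a ->
  exists x, [/\ x \in s, z < x & forall p, p \in s -> z < p -> x <= p].
Proof.
rewrite -index_mem => ia az.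
have [|i iz imin] := @arg_minP _ _ _ (Ordinal ia) [pred i : 'I_(size s) |
  z < s`_i]
  (fun i : 'I_(size s) => s`_i); first by rewrite /= nth_index -?index_mem.
exists s`_i; split=> [||p]; rewrite ?mem_nth // -index_mem => ip pz.
have /= := imin (Ordinal ip); rewrite nth_index -?index_mem //; exact.
Qed.

Lemma seq_uniform_bound (X : eqType) (s : seq X) (Q : X -> nat -> Prop) :
  (forall x, x \in s -> exists n, Q x n) ->
  exists N, forall x, x \in s -> exists2 n, (n <= N)%N & Q x n.
Proof.
elim: s => [|a s IHs] sQ; first by exists 0%N.
have [N NP] := IHs (fun x xs => sQ x (mem_behead (s := a :: s) xs)).
have [n nP] := sQ a (mem_head _ _).
exists (maxn n N) => x; rewrite inE => /orP[/eqP->|/NP[m mN mP]].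
  by exists n => //; exact: leq_maxl.
by exists m => //; rewrite leq_max mN orbT.
Qed.

Section PiecewiseTranslation.
Variables (R : realType) (l r : R) (T : R -> R) (D : seq R).
Hypothesis T_dom : forall z, l <= z < r -> l <= T z < r.
Hypothesis T_inj :
  forall y z, l <= y < r -> l <= z < r -> T y = T z -> y = z.
Hypothesis T_surj : forall z, l <= z < r -> exists2 y, l <= y < r & T y = z.
Hypothesis D_dom : forall d, d \in D -> l < d < r.
Hypothesis T_trans : forall x y, l <= x -> x <= y -> y < r ->
  (forall d, d \in D -> ~~ (x < d <= y)) -> T y - T x = y - x.
(** The endpoint [l] acts as a further discontinuity. As the image of [d0], it inherits [D_free]. *)
Variable d0 : R.
Hypothesis d0D : d0 \in D.
Hypothesis T_d0 : T d0 = l.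
Hypothesis D_free : forall d d' n, d \in D -> d' \in D ->
  iter n.+1 T d <> d'.

Notation dom z := (l <= z < r).

Lemma iter_dom n z : dom z -> dom (iter n T z).
Proof. by move=> zd; elim: n => //= n; exact: T_dom. Qed.

Lemma iter_inj n y z : dom y -> dom z -> iter n T y = iter n T z -> y = z.
Proof.
move=> yd zd; elim: n => //= n IHn /T_inj eqT; apply: IHn.
by apply: eqT; exact: iter_dom.
Qed.

Lemma iter_cancel m n y z : (m <= n)%N -> dom y -> dom z ->
  iter m T y = iter n T z -> y = iter (n - m) T z.
Proof.
move=> mn yd zd; rewrite -{1}(subnKC mn) iterD => /iter_inj -> //.
exact: iter_dom.
Qed.

(** Step [k] asks for its condition on [D] only under the conclusion at [k], so a user can reason on
    an image interval of known length. *)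
Lemma iter_trans n x y : l <= x -> x <= y -> y < r ->
  (forall k d, (k < n)%N -> d \in D -> iter k T y - iter k T x = y - x ->
     ~~ (iter k T x < d <= iter k T y)) ->
  iter n T y - iter n T x = y - x.
Proof.
move=> lx xy yr; elim: n => [|n IHn] nD; first by [].
have {}IHn : iter n T y - iter n T x = y - x.
  by apply: IHn => k d kn; apply: nD; exact: ltnW.
have xd : dom x by lra.
have yd : dom y by lra.
have := iter_dom n xd; have := iter_dom n yd => ynd xnd.
rewrite !iterS T_trans //; try lra.
by move=> d dD; exact: nD.
Qed.

Lemma iter_l n : iter n.+1 T l <> l.
Proof.
rewrite -T_d0 -iterSr iterS => /T_inj e; apply: (@D_free d0 d0 n) => //.
by apply: e; first apply: iter_dom; have := D_dom d0D; lra.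
Qed.

(* A periodic orbit lies in an interval on which T^(n+1) is a translation;
   extended to the left as far as possible, it would have a periodic
   discontinuity (or l) as left endpoint. *)
Lemma aperiodic z n : dom z -> iter n.+1 T z <> z.
Proof.
move=> zd zper.
have DN k d : d \in l :: D -> iter k.+1 T d <> d.
  by rewrite inE => /orP[/eqP->|dD]; [exact: iter_l|exact: D_free].
have permul k : iter (k * n.+1) T z = z.
  by elim: k => [//|k IHk]; rewrite mulSn iterD IHk zper.
have per k : iter n.+1 T (iter k T z) = iter k T z.
  by rewrite -iterD addnC iterD zper.
have ndD m d : d \in l :: D -> iter m T z != d.
  by move=> dD; apply/eqP => e; apply: (@DN n d dD); rewrite -e per.
(* The least positive element [e] of [pr] is how far the whole orbit can be moved left before one of
   its points meets [l] or [D]. *)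
pose pr := [seq zk - d | zk <- traject T z n.+1, d <- l :: D].
have prP m d : d \in l :: D -> iter m T z - d \in pr.
  move=> dD; apply/allpairsP; exists (iter m T z, d); split => //=.
  rewrite -/(traject T z n.+1) (divn_eq m n.+1) addnC iterD permul;
    apply/trajectP.
  by exists (m %% n.+1)%N; rewrite ?ltn_mod.
have [||e [epr e0 emin]] := @seq_min_gt R pr (z - l) 0.
- by apply: (prP 0%N); rewrite ?mem_head.
- by have := ndD 0%N l (mem_head _ _) => /= /negbTE; lra.
have [k [d [kn dD ee]]] :
    exists k d, [/\ (k < n.+1)%N, d \in l :: D & e = iter k T z - d].
  move: epr => /allpairsP[[zk d] [/trajectP[k kn zkE] dD ->]].
  by exists k, d; rewrite -zkE.
apply: (@DN n d dD); have dd : l <= d < r.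
  by move: dD; rewrite inE => /orP[/eqP->|/D_dom]; lra.
have := iter_dom k zd => zkd.
(* A discontinuity that broke this translation would give an element of [pr] strictly between 0 and
   [e]. *)
suff : iter n.+1 T (iter k T z) - iter n.+1 T d = iter k T z - d.
  by rewrite per; lra.
apply: iter_trans; [lra|lra|lra|] => j d' _ d'D jtr.
have := ndD (j + k)%N d'; rewrite inE d'D orbT => /(_ isT).
have := emin (iter (j + k) T z - d').
rewrite prP ?inE ?d'D ?orbT // => /(_ isT); rewrite iterD => + /eqP.
by move: jtr => + + ne; have [|] := ltP d' (iter j T (iter k T z)); lra.
Qed.

(* The points of ]a, b[ at which the first return map to [a, b[ may fail to be
   a translation: each of the finitely many points of a :: b :: D is reached
   from at most one of them without passing through ]a, b[. *)
Definition cut a b q p := a < p < b /\ exists2 k, iter k T p = q &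
  forall j, (0 < j <= k)%N -> ~~ (a < iter j T p < b).

(** By injectivity, the point with the shorter route to [q] lies on the route of the other one,
    which avoids ]a, b[ after its start. *)
Lemma cut_uniq a b q p p' : l <= a -> b <= r ->
  cut a b q p -> cut a b q p' -> p = p'.
Proof.
move=> la br.
have wlogP (p1 p2 : R) k k' : (k <= k')%N -> a < p1 < b -> a < p2 < b ->
    iter k T p1 = iter k' T p2 ->
    (forall j, (0 < j <= k')%N -> ~~ (a < iter j T p2 < b)) -> p1 = p2.
  move=> kk' p1P p2P /(iter_cancel kk') e nret.
  have {}e : p1 = iter (k' - k) T p2 by apply: e; lra.
  have := nret (k' - k)%N; rewrite -e p1P leq_subr andbT.
  by case: (k' - k)%N e => //= m _ /(_ isT).
move=> [pab [k kq knr]] [pab' [k' kq' knr']].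
have [kk|kk] := leqP k k'; first by apply: (wlogP p p' k k') => //; rewrite kq.
by apply/esym/(wlogP p' p k' k) => //; [exact: ltnW|rewrite kq].
Qed.

Lemma cuts_finite a b (Q : seq R) : l <= a -> b <= r ->
  exists P : seq R, forall p, p \in P <-> exists2 q, q \in Q & cut a b q p.
Proof.
move=> la br.
elim: Q => [|q Q [P PP]]; first by exists [::] => p; split => // -[].
have [[p0 qp0]|nq] := pselect (exists p, cut a b q p).
  exists (p0 :: P) => p; rewrite inE; split.
    move=> /orP[/eqP->|/PP[q' q'Q q'p]]; first by exists q; rewrite ?mem_head.
    by exists q'; rewrite // inE q'Q orbT.
  move=> [q']; rewrite inE => /orP[/eqP->/(cut_uniq la br)/(_ qp0)->|q'Q q'p].
    by rewrite eqxx.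
  by apply/orP; right; apply/PP; exists q'.
exists P => p; rewrite PP; split => -[q' q'Q q'p].
  by exists q'; rewrite // inE q'Q orbT.
move: q'Q q'p; rewrite inE => /orP[/eqP->|q'Q q'p]; last by exists q'.
by move=> qp; case: nq; exists p.
Qed.

(** The finitely many cuts divide [a, b[ into pieces, and all points of a piece return at a common
    time. The largest of these times is the bound. *)
Lemma bounded_return a b : l <= a -> a < b -> b <= r ->
  exists N, forall z, a <= z < b ->
    exists2 n, (0 < n <= N)%N & a <= iter n T z < b.
Proof.
move=> la ab br; have [P PP] := cuts_finite (a :: b :: D) la br.
have Pin p : p \in P -> a < p < b by move=> /PP[q _ []].
pose piece x z := x <= z < b /\ forall p, p \in P -> ~~ (x < p <= z).
suff ret x : x \in a :: P -> exists n, (0 < n)%N /\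
    forall z, piece x z -> a <= iter n T z < b.
  have [N NP] := seq_uniform_bound ret.
  exists N => z zab; have [|x [xP xz xmax]] :=
    @seq_max_le _ (a :: P) a z (mem_head _ _).
    by lra.
  have [n nN [n0 nP]] := NP x xP; exists n; first by rewrite n0.
  apply: nP; split; first by lra.
  move=> p pP; apply/negP => /andP[xp pz].
  by have := xmax p; rewrite inE pP orbT => /(_ isT pz); lra.
move=> xP; have xab : a <= x < b.
  by move: xP; rewrite inE => /orP[/eqP->|/Pin]; lra.
have pieceS u z : piece x z -> x <= u <= z -> piece x u.
  move=> [xz zP] xuz; split; first lra.
  by move=> p /zP; apply: contra; lra.
have piecex : piece x x by split => [|p _]; lra.
have ndom z : piece x z -> dom z by move=> []; lra.
(* As long as nothing returns, a piece moves rigidly: the point [u] sent to a discontinuity would be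
   a cut inside the piece. *)
have trans m :
    (forall j z, (0 < j < m)%N -> piece x z -> ~~ (a <= iter j T z < b)) ->
    forall z, piece x z -> iter m T z - iter m T x = z - x.
  elim: m => [//|m IHm] nret.
  have {}IHm : forall z, piece x z -> iter m T z - iter m T x = z - x.
    by apply: IHm => j z /andP[j0 jm]; apply: nret; rewrite j0 ltnW.
  move=> z xz; have xzm := IHm z xz; have := xz => -[xzb _].
  have := iter_dom m (ndom z xz); have := iter_dom m (ndom x piecex) => xd zd.
  rewrite !iterS T_trans //; [lra|lra|lra|].
  move=> d dD; apply/negP => dxz.
  pose u := x + (d - iter m T x).
  have xu : piece x u by apply: pieceS xz _; rewrite /u; lra.
  have [_ /(_ u)] := xu; have -> : x < u <= u by rewrite /u; lra.
  move=> uP; suff /uP : u \in P by [].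
  apply/PP; exists d; first by rewrite !inE dD !orbT.
  split; first by rewrite /u; lra.
  exists m; first by have := IHm u xu; rewrite /u; lra.
  move=> j /andP[j0 jm]; apply/negP => juab.
  by have := nret j u; rewrite j0 ltnS jm => /(_ isT xu); lra.
have [n [n0 [z0 xz0 z0ab]]] :
    exists n, (0 < n)%N /\ exists2 z, piece x z & a <= iter n T z < b.
  (* Without a return, the images of [x, y[, where [y] is the next cut or [b], are pairwise
     disjoint: an overlap pulls back by injectivity to a return. Too many intervals of equal length
     would then fit in [l, r[. *)
  apply: contrapT => nret.
  have {}nret j z : (0 < j)%N -> piece x z -> ~~ (a <= iter j T z < b).
    by move=> j0 xz; apply/negP => jzab; apply: nret; exists j; split => //;
      exists z.
  have [||y [yP xy ymin]] := @seq_min_gt _ (b :: P) b x;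
    rewrite ?mem_head //; first lra.
  have piecey u : x <= u < y -> piece x u.
    move=> xuy; have := ymin b (mem_head _ _) => yb; split; first lra.
    move=> p pP; have := ymin p; rewrite inE pP orbT => /(_ isT); lra.
  have step k u : x <= u < y -> iter k T u = iter k T x + (u - x).
    move=> xuy; have := trans k (fun j z jk =>
      nret j z (andP jk).1) u (piecey _ xuy).
    lra.
  have disj j k : (j < k)%N -> iter j T x <= iter k T x -> 
      iter j T x + (y - x) <= iter k T x.
    move=> jk xjk; rewrite leNgt; apply/negP => kxj.
    pose u := x + (iter k T x - iter j T x).
    have xuy : x <= u < y by rewrite /u; lra.
    have : iter j T u = iter k T x by rewrite (step j u xuy) /u; lra.
    move/iter_cancel; rewrite (ltnW jk) =>
      /(_ isT (ndom _ (piecey _ xuy)) (ndom _ piecex)).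
    move=> uE; have := nret (k - j)%N x;
      rewrite subn_gt0 jk -uE => /(_ isT piecex).
    by have := piecey _ xuy => -[]; lra.
  have disj' j k : (j < k)%N -> iter k T x <= iter j T x -> 
      iter k T x + (y - x) <= iter j T x.
    move=> jk xjk; rewrite leNgt; apply/negP => kxj.
    pose u := x + (iter j T x - iter k T x).
    have xuy : x <= u < y by rewrite /u; lra.
    have : iter j T x = iter k T u by rewrite (step k u xuy) /u; lra.
    move/iter_cancel; rewrite (ltnW jk) =>
      /(_ isT (ndom _ piecex) (ndom _ (piecey _ xuy))).
    move=> xE; have := nret (k - j)%N u;
      rewrite subn_gt0 jk -xE => /(_ isT (piecey _ xuy)).
    by lra.
  pose M := Num.truncn ((r - l) / (y - x)).
  have lenM : (r - l) < (y - x) *+ M.+1.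
    rewrite -mulr_natr mulrC -ltr_pdivrMr; last lra.
    by apply: Num.Theory.truncnS_gt.
  have := @packing_pred _ 'I_M.+1 (fun i => iter i T x) (fun _ =>
    y - x) _ _ xpredT l r.
  rewrite sumr_const card_ord => pk.
  suff : (y - x) *+ M.+1 <= r - l by rewrite leNgt lenM.
  apply: pk => [_|i j ij ij'||i _]; [lra| |lra|].
    by case: (ltngtP i j) => [/disj|/disj'|/val_inj/eqP];
      rewrite ?(negbTE ij) //; exact.
  have xd := iter_dom i (ndom _ piecex); split; first lra.
  rewrite leNgt; apply/negP => rx; pose u := x + (r - iter i T x).
  have xuy : x <= u < y by rewrite /u; lra.
  by have := iter_dom i (ndom _ (piecey _ xuy)); rewrite (step i u xuy) /u; lra.
pose hit n := (0 < n)%N && `[< exists2 z, piece x z & a <= iter n T z < b >].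
have [|{n0 z0 xz0 z0ab}n /andP[n0 /asboolP[z0 xz0 z0ab]] nmin] :=
    @ex_minnP hit.
  by exists n; rewrite /hit n0; apply/asboolP; exists z0.
have nret j z : (0 < j < n)%N -> piece x z -> ~~ (a <= iter j T z < b).
  move=> /andP[j0 jn] xz; apply/negP => jzab.
  suff /nmin : hit j by rewrite leqNgt jn.
  by rewrite /hit j0; apply/asboolP; exists z.
have {}trans := trans n nret.
exists n; split => // z xz.
have tz := trans z xz; have tz0 := trans z0 xz0.
(* This is why [a] and [b] were added to [D]: at the least return time the piece cannot straddle an
   end of [a, b[, since the point sent there would be a cut. *)
have cutP u q : piece x u -> x < u -> q \in [:: a;
  b] -> iter n T u = q -> False.
  move=> xu ltxu qab uq; have [uxb /(_ u)] := xu; rewrite ltxu lexx => uP.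
  suff /uP : u \in P by [].
  apply/PP; exists q; first by move: qab; rewrite !inE => /orP[]->;
    rewrite ?orbT.
  split; first by lra.
  exists n => // j /andP[j0]; rewrite leq_eqVlt => /orP[/eqP->|jn].
    by rewrite uq; move: qab; rewrite !inE => /orP[]/eqP->; lra.
  by apply/negP => juab; have := nret j u; rewrite j0 jn => /(_ isT xu); lra.
have xz' : x <= z by case: xz; lra.
have xz0' : x <= z0 by case: xz0; lra.
rewrite leNgt (ltNge _ b); apply/andP; split; apply/negP => zn.
  pose u := z + (a - iter n T z).
  have xu : piece x u by apply: pieceS xz0 _; rewrite /u; lra.
  by apply: (@cutP u a) => //; rewrite ?inE ?eqxx ?orbT //;
    have := trans u xu; rewrite /u; lra.
pose u := z0 + (b - iter n T z0).
have xu : piece x u by apply: pieceS xz _; rewrite /u; lra.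
by apply: (@cutP u b) => //; rewrite ?inE ?eqxx ?orbT //; have := trans u xu;
  rewrite /u; lra.
Qed.

(** One-sided on purpose: the sets considered are built from semi-intervals and are constant just to
    the right of every point, so a change shows only from the left. *)
Definition boundary (K : set R) p := l < p < r /\
  forall x, l <= x < p -> exists2 u, x < u < p & ~ (K u <-> K p).

Definition locally_constant_right (K : set R) := forall p, dom p ->
  exists2 y, p < y <= r & forall u, p <= u < y -> (K u <-> K p).

Lemma boundaryPn K p : l < p < r -> ~ boundary K p ->
  exists2 x, l <= x < p & forall u, x < u < p -> (K u <-> K p).
Proof.
move=> pd nbd; apply: contrapT => nx; apply: nbd; split => // x xp.
apply: contrapT => nu; apply: nx; exists x => // u xu.
by apply: contrapT => KuKp; apply: nu; exists u.
Qed.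

Lemma boundaryU A B p : boundary (A `|` B) p -> boundary A p \/ boundary B p.
Proof.
move=> [pd bdAB]; apply: contrapT => /not_orP[nA nB].
have [x xp Ax] := boundaryPn pd nA; have [y yp By] := boundaryPn pd nB.
have [|u up] := bdAB (Num.max x y).
  by case: (leP x y); lra.
have [xu yu] : x < u < p /\ y < u < p by move: up; case: (leP x y); lra.
have := Ax u xu; have := By u yu; rewrite /setU /=; tauto.
Qed.

Lemma locally_constant_rightU A B :
  locally_constant_right A -> locally_constant_right B ->
  locally_constant_right (A `|` B).
Proof.
move=> lA lB p pd; have [x xp Ax] := lA p pd; have [y yp By] := lB p pd.
exists (Num.min x y) => [|u up]; first by case: (leP x y); lra.
have [xu yu] : p <= u < x /\ p <= u < y by move: up; case: (leP x y); lra.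
have := Ax u xu; have := By u yu; rewrite /setU /=; tauto.
Qed.

Lemma T_right p : dom p ->
  exists2 y, p < y <= r & forall u, p <= u < y -> T u - T p = u - p.
Proof.
move=> pd; have [||y [_ py ymin]] := @seq_min_gt _ (r :: D) r p.
- exact: mem_head.
- lra.
have yr := ymin r (mem_head _ _); exists y => [|u pu]; first by lra.
apply: T_trans; [lra|lra|lra|] => d dD; apply/negP => dp.
by have := ymin d; rewrite inE dD orbT => /(_ isT); lra.
Qed.

Lemma T_left p : l < p < r -> p \notin D ->
  exists2 x, l <= x < p & forall u, x <= u <= p -> T p - T u = p - u.
Proof.
move=> pd pnD; have [||x [xD xp xmax]] := @seq_max_le _ (l :: D) l p.
- exact: mem_head.
- lra.
have lx := xmax l (mem_head _ _).
have xnp : x != p.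
  by move: xD; rewrite inE => /orP[/eqP->|xD];
    [lra|apply: contraNneq pnD => <-].
exists x => [|u xu]; first by move/eqP: xnp; lra.
apply: T_trans; [lra|lra|lra|] => d dD; apply/negP => dp.
by have := xmax d; rewrite inE dD orbT => /(_ isT); lra.
Qed.

Lemma T_gt_l p : l < p < r -> p \notin D -> l < T p < r.
Proof.
move=> pd pnD; have pd' : dom p by lra.
have := T_dom pd'; rewrite le_eqVlt => /andP[/orP[/eqP lTp|->] ->//].
have d0d := D_dom d0D; case/negP: pnD.
by rewrite -(@T_inj d0 p) //; [lra|rewrite T_d0].
Qed.

(** Off [D] the map translates a left neighbourhood of [p]. Since only [d0] is sent to [l], the
    image of [p] is still interior. *)
Lemma boundary_preimage K p : l < p < r -> p \notin D ->
  boundary (K \o T) p <-> boundary K (T p).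
Proof.
move=> pd pnD; have Tpd := T_gt_l pd pnD.
have [x xp xT] := T_left pd pnD; split=> -[_ bd]; split=> // y yp.
  have [|u up KT] := bd (Num.max x (p - (T p - y))).
    by case: (leP x (p - (T p - y))); lra.
  exists (T u) => //; have := xT u.
  by move: up; case: (leP x (p - (T p - y))); lra.
have [|u up KT] := bd (Num.max (T p - (p - x)) (T p - (p - y))).
  have xd : dom x by lra.
  have := xT x; have := T_dom xd.
  by case: (leP (T p - (p - x)) (T p - (p - y))); lra.
exists (p - (T p - u)).
  by move: up; case: (leP (T p - (p - x)) (T p - (p - y))); lra.
have -> : (K \o T) (p - (T p - u)) = K u.
  have := xT (p - (T p - u)) => Tu; congr K.
  by move: up; case: (leP (T p - (p - x)) (T p - (p - y))); lra.
by [].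
Qed.

Lemma locally_constant_right_preimage K :
  locally_constant_right K -> locally_constant_right (K \o T).
Proof.
move=> lK p pd; have [x xp Tx] := T_right pd; have [y yp Ky] := lK _ (T_dom pd).
exists (Num.min x (p + (y - T p))) => [|u up].
  by case: (leP x (p + (y - T p))); lra.
apply: Ky; have := Tx u; move: up.
by case: (leP x (p + (y - T p))); lra.
Qed.

(** Connectedness of the interval: agreement with [l] holds up to a supremum [c], passes to [c]
    because it is not a boundary point, and then extends beyond it. *)
Lemma locally_constant K : locally_constant_right K ->
  (forall p, ~ boundary K p) -> forall z, dom z -> (K z <-> K l).
Proof.
move=> lK nbd z zd; apply: contrapT => Kz.
pose S := [set t | dom t /\ forall u, l <= u <= t -> (K u <-> K l)].
have lS : S l by split=> [|u lu]; [lra|have -> : u = l by lra].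
have Sz t : S t -> t < z.
  by move=> [td tK]; rewrite ltNge; apply/negP => zt; apply: Kz; apply: tK; lra.
have supS : has_sup S by split; [exists l|exists z => t /Sz/ltW].
have lc : l <= sup S by apply: sup_upper_bound.
have cz : sup S <= z by apply: sup_le_ub; [exists l|move=> t /Sz/ltW].
set c := sup S in lc cz.
have below u : l <= u < c -> (K u <-> K l).
  move=> luc; have [|t [td tK]] := @sup_adherent _ S (c - u) _ supS; first lra.
  by rewrite -/c => ut; apply: tK; lra.
have Kc : K c <-> K l.
  have [->//|cl] := eqVneq c l.
  have [|x xc Kx] := @boundaryPn K c _ (nbd c); first by move/eqP: cl; lra.
  have xcc : x < (x + c) / 2 < c by lra.
  have lcc : l <= (x + c) / 2 < c by lra.
  by have := Kx _ xcc; have := below _ lcc; tauto.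
have [|y cy Ky] := lK c; first lra.
have /(sup_upper_bound supS) : S ((c + y) / 2).
  split=> [|u lu]; first lra.
  have [uc|cu] := ltP u c; first by apply: below; lra.
  by apply: (iff_trans _ Kc); apply: Ky; lra.
by rewrite -/c; lra.
Qed.

Lemma seq_pigeonhole (X : eqType) (s : seq X) (g : nat -> X) :
  (forall i, g i \in s) -> exists i j, (i < j)%N /\ g i = g j.
Proof.
move=> gs; apply: contrapT => ng.
have ginj : injective g.
  move=> i j gij; apply: contrapT => ne; apply: ng.
  by case: (ltngtP i j) => // lij; [exists i, j|exists j, i].
have /uniq_leq_size uls : uniq (mkseq g (size s).+1).
  by rewrite map_inj_uniq ?iota_uniq.
suff /uls : {subset mkseq g (size s).+1 <= s} by rewrite size_mkseq ltnn.
by move=> x /mapP[i _ ->].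
Qed.

Lemma T_right_inverse : exists g, forall z, dom z -> dom (g z) /\ T (g z) = z.
Proof.
suff /choice[g gP] : forall z, exists y, dom z -> dom y /\ T y = z by exists g.
move=> z; have [zd|nz] := pselect (dom z); last by exists z.
by have [y yd yz] := T_surj zd; exists y.
Qed.

Fixpoint hits (J : set R) N : set R :=
  if N is N'.+1 then J `|` (hits J N' \o T) else J.

Lemma hitsP J N z : hits J N z <-> exists2 n, (n <= N)%N & J (iter n T z).
Proof.
elim: N z => [|N IHN] z /=.
  by split=> [Jz|[n]]; [exists 0%N|rewrite leqn0 => /eqP->].
split=> [[Jz|/IHN[n nN Jn]]|[[|n] nN Jn]]; first by exists 0%N.
- by exists n.+1; rewrite ?iterSr.
- by left.
- by right; apply/IHN; exists n => //; rewrite -iterSr.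
Qed.

(** Each further step adds to the possible boundary points only [a], [b], the points of [D] and one
    preimage of each earlier one. *)
Lemma hits_tame a b N : l <= a -> a < b -> b <= r ->
  locally_constant_right (hits [set z | a <= z < b] N) /\
  exists s : seq R, forall p, boundary (hits [set z | a <= z < b] N) p ->
    p \in s.
Proof.
move=> la ab br; set J := [set z | _].
have [lJ bJ] : locally_constant_right J /\ forall p, boundary J p ->
  p \in [:: a; b].
  split=> [p pd|p [pd bd]].
    have [pa|ap] := ltP p a.
      by exists a => [|u pu]; rewrite /J /=; lra.
    have [pb|bp] := ltP p b.
      by exists b => [|u pu]; rewrite /J /=; lra.
    by exists r => [|u pu]; rewrite /J /=; lra.
  apply/negPn/negP; rewrite !inE => /norP[/eqP pa /eqP pb].
  have [lpa|lap] := ltP p a.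
    by have [|u up] := bd l; [lra|case; rewrite /J /=; lra].
  have [lpb|lbp] := ltP p b.
    by have [|u up] := bd a; [lra|case; rewrite /J /=; lra].
  by have [|u up] := bd b; [lra|case; rewrite /J /=; lra].
have [g gP] := T_right_inverse.
elim: N => [|N [lN [s bs]]]; first by split=> //; exists [:: a; b].
split; first exact/(locally_constant_rightU lJ)/locally_constant_right_preimage.
exists ([:: a; b] ++ D ++ map g s) => p /boundaryU[/bJ|bdp].
  by rewrite !mem_cat => ->.
rewrite !mem_cat; have [//|pD] := boolP (p \in D); first by rewrite orbT.
have [pd _] := bdp; have /bs Tps := (boundary_preimage _ pd pD).1 bdp.
have pd' : dom p by lra.
have [gd gT] := gP _ (T_dom pd').
by apply/orP; right; apply/mapP; exists (T p) => //; exact/esym/T_inj.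
Qed.

(* The points of ]l, r[ at which an invariant set changes are permuted by T
   away from D; being finitely many and not periodic, they come from D and
   run into D, which contradicts D_free. *)
Theorem minimality a b z : l <= a -> a < b -> b <= r -> dom z ->
  exists n, a <= iter n T z < b.
Proof.
move=> la ab br zd; have [N NP] := bounded_return la ab br.
have [lU [s bs]] := hits_tame N la ab br.
set J := [set z | a <= z < b] in lU bs; set U := hits J N in lU bs.
(* If the known visit to [J] is at time 0, [NP] supplies a later one within the bound. *)
have forw y : U y -> U (T y).
  move=> /hitsP[[|n] nN Jn]; apply/hitsP; last first.
    by exists n; [exact: ltnW|rewrite -iterSr].
  by have [[//|m] mN Jm] := NP y Jn; exists m; [exact: ltnW|rewrite -iterSr].
have forwn n y : U y -> U (iter n T y) by elim: n => //= n IHn /IHn/forw.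
(* Backward invariance comes from recurrence: [y] returns to a short interval [y, c[ on which [U] is
   constant, and it does so through [T y], which already lies in [U]. *)
have back y : dom y -> U (T y) -> U y.
  move=> yd UTy; apply: contrapT => nUy; have [c yc cU] := lU y yd.
  have [|||N' /(_ y)[|[//|n] _ /cU[Un _]]] := @bounded_return y c;
    [lra|lra|lra|lra|].
  apply/nUy/Un; rewrite iterSr; exact: forwn.
suff /hitsP[n _ Jn] : U z by exists n.
apply: contrapT => nUz.
have [p bdp] : exists p, boundary U p.
  apply: contrapT => nbd; apply: nUz.
  have cst := locally_constant lU (fun p bdp => nbd (ex_intro _ p bdp)).
  apply/(cst z zd)/(cst a); first lra.
  by apply/hitsP; exists 0%N => //; rewrite /J /=; lra.
have bdT q : l < q < r -> q \notin D -> boundary U q <-> boundary U (T q).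
  move=> qd qD; rewrite -boundary_preimage //.
  have UT u : l <= u < r -> (U u <-> U (T u)) by move=> ud; split;
    [exact: forw|exact: back].
  split=> -[_ bd]; split => // x xq; have [u uq Uu] := bd x xq; exists u => //;
    have ud : l <= u < r by lra.
    by have := UT u ud; have := UT q (ltac:(lra)); rewrite /comp; tauto.
  by have := UT u ud; have := UT q (ltac:(lra)); move: Uu; rewrite /comp; tauto.
have pd : dom p by case: bdp; lra.
have [m mD] : exists m, iter m T p \in D.
  apply: contrapT => nD.
  have bdm m : boundary U (iter m T p).
    elim: m => [//|m IHm]; have [md _] := IHm; apply/(bdT _ md _).1 => //.
    by apply/negP => mD; apply: nD; exists m.
  have [i [j [ij]]] := seq_pigeonhole (fun i => bs _ (bdm i)).
  move=> /(iter_cancel (ltnW ij) pd pd).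
  have : (0 < j - i)%N by rewrite subn_gt0.
  by case: (j - i)%N => // k _ /esym/(aperiodic pd).
have [g gP] := T_right_inverse.
have gd k : dom (iter k g p) by elim: k => //= k IHk; case: (gP _ IHk).
have gT k : iter k T (iter k g p) = p.
  by elim: k => //= k IHk; rewrite -iterS iterSr (gP _ (gd k)).2.
(* [l] is included because [bdT] needs interior points. The successor ensures that at least one step
   separates the two discontinuities found. *)
have [k kD] : exists k, iter k.+1 g p \in l :: D.
  apply: contrapT => nD.
  have bdk k : boundary U (iter k g p).
    elim: k => //= k IHk.
    have : iter k.+1 g p \notin l :: D by apply/negP => kD; apply: nD; exists k.
    rewrite inE => /norP[/eqP kl kD]; have := gd k.+1 => /= kd.
    apply/(bdT _ _ kD).2; first by move: kl => /= kl; lra.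
    by rewrite /= (gP _ (gd k)).2.
  have [i [j [ij e]]] := seq_pigeonhole (fun i => bs _ (bdk i)).
  have : iter j T (iter j g p) = iter i T (iter j g p) by rewrite gT -e gT.
  move=> /esym/(iter_cancel (ltnW ij) (gd j) (gd j)).
  have : (0 < j - i)%N by rewrite subn_gt0.
  by case: (j - i)%N => // h _ /esym/(aperiodic (gd j)).
have := mD; rewrite -(gT k.+1) -iterD addnS.
move: kD; rewrite inE => /orP[/eqP->|kD] dD; last by case: (D_free kD dD erefl).
by move: dD; rewrite -T_d0 -iterSr => dD; case: (D_free d0D dD erefl).
Qed.

End PiecewiseTranslation.

(** * Interval exchange transformations *)

Lemma card_le_inj_in (X Y : finType) (P : {pred X}) (Q : {pred Y}) (g : X -> Y)
  :
  {in P, forall x, g x \in Q} -> {in P &, injective g} -> (#|P| <= #|Q|)%N.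
Proof.
move=> PQ ginj; rewrite -(card_in_image ginj).
apply: subset_leq_card; apply/fintype.subsetP => y /fintype.imageP[x xP ->].
exact: PQ.
Qed.

(** * Partial sums of lengths along a total order *)

Section OrderedSums.
Variables (R : realType) (A : finType) (le : rel A) (len : A -> R).

Lemma total_order_refl : total_order le -> reflexive le.
Proof. by move=> [le_total _ _] a; have := le_total a a; rewrite orbb. Qed.

Lemma sum_le_lt a : total_order le -> \sum_(b | le b a) len b =
  \sum_(b | (b != a) && le b a) len b + len a.
Proof.
move=> le_o; rewrite (bigD1 a) ?total_order_refl //= addrC.
by congr (_ + _); apply: eq_bigl => b; rewrite andbC.
Qed.

Hypothesis len_gt0 : forall a, 0 < len a.

Lemma sum_le_lt_mono a b : total_order le -> a != b -> le a b ->
  \sum_(c | le c a) len c <= \sum_(c | (c != b) && le c b) len c.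
Proof.
move=> [_ asym trans] ab leab; rewrite [leRHS](bigID (le^~ a)) /=.
rewrite [X in _ <= X + _](eq_bigl (le^~ a)) => [|c].
  by rewrite lerDl sumr_ge0 // => c _; exact: ltW.
have [leca|] := boolP (le c a); last by rewrite andbF.
rewrite (trans _ _ _ leca leab) !andbT; apply: contraNneq ab => cb.
by apply/eqP/asym; rewrite leab -cb.
Qed.

Lemma ordered_sum_apart a b : total_order le -> a != b ->
  \sum_(c | le c a) len c - len a <= \sum_(c | le c b) len c - len b ->
  \sum_(c | le c a) len c <= \sum_(c | le c b) len c - len b.
Proof.
move=> le_o ab; rewrite !sum_le_lt // !addrK -sum_le_lt //.
have [le_total _ _] := le_o; have /orP[leab|leba] := le_total a b.
  by rewrite sum_le_lt_mono.
rewrite eq_sym in ab; have := sum_le_lt_mono le_o ab leba.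
by rewrite sum_le_lt //; have := len_gt0 b; lra.
Qed.

Lemma ordered_sum_inside a : total_order le ->
  0 <= \sum_(c | le c a) len c - len a /\
  \sum_(c | le c a) len c <= \sum_c len c.
Proof.
move=> le_o; split.
  by rewrite sum_le_lt // addrK sumr_ge0 // => c _; exact: ltW.
by rewrite [leRHS](bigID (le^~ a)) /= lerDl sumr_ge0 // => c _; exact: ltW.
Qed.

End OrderedSums.

Section Iet.
Variables (R : realType) (A : finType) (T : iet R A).
Local Notation l := (iet_left T).
Local Notation r := (iet_right T).
Local Notation len := (iet_len T).
Local Notation gamma := (iet_gamma T).
Local Notation map := (iet_map T).

(* The left endpoint of the image of the semi-interval of a. *)
Definition iet_tau a := iet_nu T a - len a.
Local Notation tau := iet_tau.

Lemma iet_domE z : (z \in iet_dom T) = (l <= z < r).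
Proof. by rewrite in_itv. Qed.

Lemma iet_gammaE a : gamma a = iet_mu T a - len a.
Proof.
by rewrite /iet_mu sum_le_lt ?addrA ?addrK //; exact: iet_le1_order.
Qed.

Lemma iet_itvE a z : (z \in iet_itv T a) = (gamma a <= z < gamma a + len a).
Proof. by rewrite in_itv /= iet_gammaE subrK. Qed.

Lemma iet_gamma_apart a b : a != b -> gamma a <= gamma b ->
  gamma a + len a <= gamma b.
Proof.
move=> ab; rewrite !iet_gammaE subrK /iet_mu -!addrA !lerD2l.
by apply: ordered_sum_apart => //; [exact: iet_len_gt0|exact: iet_le1_order].
Qed.

Lemma iet_tau_apart a b : a != b -> tau a <= tau b -> tau a + len a <= tau b.
Proof.
move=> ab; rewrite /tau subrK /iet_nu -!addrA !lerD2l.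
by apply: ordered_sum_apart => //; [exact: iet_len_gt0|exact: iet_le2_order].
Qed.

Lemma iet_gamma_inside a : l <= gamma a /\ gamma a + len a <= r.
Proof.
rewrite iet_gammaE subrK /iet_mu /iet_right -addrA lerDl lerD2l.
by apply: ordered_sum_inside; [exact: iet_len_gt0|exact: iet_le1_order].
Qed.

Lemma iet_tau_inside a : l <= tau a /\ tau a + len a <= r.
Proof.
rewrite /tau subrK /iet_nu /iet_right -addrA lerDl lerD2l.
by apply: ordered_sum_inside; [exact: iet_len_gt0|exact: iet_le2_order].
Qed.

Lemma iet_gamma_bound a : l <= gamma a < r.
Proof. by have := iet_gamma_inside a; have := iet_len_gt0 T a; lra. Qed.

Lemma iet_sum_len : \sum_a len a = r - l.
Proof. by rewrite /iet_right addrAC subrr add0r. Qed.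

Lemma iet_cover z : l <= z < r -> exists a, z \in iet_itv T a.
Proof.
move=> /(tile_cover (iet_len_gt0 T) iet_gamma_apart iet_gamma_inside
  iet_sum_len).
by move=> [a az]; exists a; rewrite iet_itvE.
Qed.

Lemma iet_tau_cover z : l <= z < r -> exists a, tau a <= z < tau a + len a.
Proof.
exact: (tile_cover (iet_len_gt0 T) iet_tau_apart iet_tau_inside iet_sum_len).
Qed.

Lemma iet_itv_inj a b z : z \in iet_itv T a -> z \in iet_itv T b -> a = b.
Proof.
rewrite !iet_itvE => za zb; apply/eqP; apply: contraT => ab.
have [leab|/ltW leba] := leP (gamma a) (gamma b).
  by have := iet_gamma_apart ab leab; lra.
by rewrite eq_sym in ab; have := iet_gamma_apart ab leba; lra.
Qed.

Lemma iet_itv_dom a z : z \in iet_itv T a -> l <= z < r.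
Proof. by rewrite iet_itvE; have := iet_gamma_inside a; lra. Qed.

Lemma iet_letterP a z : iet_letter T z = Some a <-> z \in iet_itv T a.
Proof.
rewrite /iet_letter; case: pickP => [b zb|nz]; last by rewrite nz.
by split=> [[<-//]|/(iet_itv_inj zb)->].
Qed.

Lemma iet_mapE a z : z \in iet_itv T a -> map z = z - gamma a + tau a.
Proof.
by move=> za; rewrite /iet_map ((iet_letterP a z).2 za) iet_gammaE /tau; lra.
Qed.

Lemma iet_gamma_itv a : gamma a \in iet_itv T a.
Proof. by rewrite iet_itvE; have := iet_len_gt0 T a; lra. Qed.

Lemma iet_map_gamma a : map (gamma a) = tau a.
Proof. by rewrite (iet_mapE (iet_gamma_itv a)); lra. Qed.

Lemma iet_map_dom z : l <= z < r -> l <= map z < r.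
Proof.
move=> /iet_cover[a za]; rewrite (iet_mapE za); move: za; rewrite iet_itvE.
by have := iet_tau_inside a; lra.
Qed.

Lemma iet_map_inj y z : l <= y < r -> l <= z < r -> map y = map z -> y = z.
Proof.
move=> /iet_cover[a ya] /iet_cover[b zb].
rewrite (iet_mapE ya) (iet_mapE zb); move: ya zb; rewrite !iet_itvE.
have [<-|ab] := eqVneq a b; first by lra.
have [leab|/ltW leba] := leP (tau a) (tau b).
  by have := iet_tau_apart ab leab; lra.
by rewrite eq_sym in ab; have := iet_tau_apart ab leba; lra.
Qed.

Lemma iet_map_surj z : l <= z < r -> exists2 y, l <= y < r & map y = z.
Proof.
move=> /iet_tau_cover[a az]; have za : z - tau a + gamma a \in iet_itv T a.
  by rewrite iet_itvE; lra.
by exists (z - tau a + gamma a);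
  [exact: iet_itv_dom za|rewrite (iet_mapE za); lra].
Qed.

Lemma iet_iter_dom n z : l <= z < r -> l <= iter n map z < r.
Proof. exact: (iter_dom iet_map_dom). Qed.

Lemma iet_iter_inj n y z : l <= y < r -> l <= z < r ->
  iter n map y = iter n map z -> y = z.
Proof. exact: (iter_inj iet_map_dom iet_map_inj). Qed.

Lemma iet_iter_cancel m n y z : (m <= n)%N -> l <= y < r -> l <= z < r ->
  iter m map y = iter n map z -> y = iter (n - m) map z.
Proof. exact: (iter_cancel iet_map_dom iet_map_inj). Qed.

Lemma iet_nonfirstP a : iet_nonfirst T a <-> l < gamma a.
Proof.
rewrite /iet_gamma ltrDl; split=> [[b ba]|ga].
  rewrite (bigD1 b) //= ltr_wpDr ?iet_len_gt0 //.
  by rewrite sumr_ge0 // => c _; exact/ltW/iet_len_gt0.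
apply: contrapT => nb; move: ga; rewrite big1 ?ltxx // => b ba.
by case: nb; exists b.
Qed.

Lemma iet_gamma_inj a b : gamma a = gamma b -> a = b.
Proof.
move=> e; have := iet_gamma_itv b; rewrite -e; apply: iet_itv_inj.
exact: iet_gamma_itv.
Qed.

(** Exactly one piece starts at [l]. Alphabets can thus be compared by counting separation
    points. *)
Lemma iet_card (c : A) : #|A| = #|[pred a | l < gamma a]|.+1.
Proof.
have [|a la] := @iet_cover l; first by have := iet_gamma_bound c; lra.
have {}la : gamma a = l.
  by move: la; rewrite iet_itvE; have := iet_gamma_bound a; lra.
rewrite -(cardC [pred a | l < gamma a]) -addn1; congr (_ + _)%N.
rewrite -(card1 a); apply: eq_card => b; rewrite !inE -leNgt.
apply/idP/eqP => [bl|->]; last by rewrite la.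
by apply: iet_gamma_inj; have := iet_gamma_bound b; lra.
Qed.

Lemma iet_map_trans x y : l <= x -> x <= y -> y < r ->
  (forall a, iet_nonfirst T a -> ~~ (x < gamma a <= y)) ->
  map y - map x = y - x.
Proof.
move=> lx xy yr xyD.
have [|a xa] := @iet_cover x; first lra.
have [|b yb] := @iet_cover y; first lra.
have xb : x \in iet_itv T b.
  move: yb; rewrite !iet_itvE => yb; have := xyD b.
  by rewrite iet_nonfirstP => h; have [|] := leP (gamma b) x; lra.
by rewrite (iet_mapE xb) (iet_mapE yb); lra.
Qed.

Definition iet_cuts := [seq gamma a | a <- enum A & `[<iet_nonfirst T a>]].

Lemma iet_cutsP d : d \in iet_cuts <-> exists2 a,
  iet_nonfirst T a & d = gamma a.
Proof.
split=> [/mapP[a]|[a na ->]].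
  by rewrite mem_filter => /andP[/asboolP na _] ->; exists a.
by apply/mapP; exists a => //; rewrite mem_filter mem_enum andbT; apply/asboolP.
Qed.

Lemma iet_orbitE z y : iet_orbit T z y <->
  l <= y < r /\ exists n, y = iter n map z \/ z = iter n map y.
Proof. by rewrite /iet_orbit /= iet_domE. Qed.

Lemma periodic_orbit_finite n z : l <= z < r -> iter n.+1 map z = z ->
  finite_set (iet_orbit T z).
Proof.
move=> zd zper.
have permul k : iter (k * n.+1) map z = z.
  by elim: k => [//|k IHk]; rewrite mulSn iterD IHk zper.
apply: (@sub_finite_set _ _ [set` traject map z n.+1]); last exact: finite_seq.
move=> y /iet_orbitE[yd [m [->|zy]]].
  change (iter m map z \in traject map z n.+1);
    rewrite (divn_eq m n.+1) addnC iterD permul; apply/trajectP.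
  by exists (m %% n.+1)%N; rewrite ?ltn_mod.
(* A backward orbit point is also a forward one: [z] is replaced by its iterate at a multiple of the
   period that is at least [m]. *)
have mm : (m <= m * n.+1)%N by rewrite leq_pmulr.
have : iter m map y = iter (m * n.+1) map z by rewrite permul.
move/(iet_iter_cancel mm yd zd) => ->; set k := (_ - _)%N.
change (iter k map z \in traject map z n.+1);
  rewrite (divn_eq k n.+1) addnC iterD permul; apply/trajectP.
by exists (k %% n.+1)%N; rewrite ?ltn_mod.
Qed.

(** * Consequences of regularity *)

Section Regular.
Hypothesis regT : iet_regular T.

Lemma regular_free a b n : iet_nonfirst T a -> iet_nonfirst T b ->
  iter n.+1 map (gamma a) <> gamma b.
Proof.
move=> na nb e; have [inf disj] := regT.
have [ab|ab] := eqVneq a b.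
  by apply: (inf a na); apply: (@periodic_orbit_finite n);
    [exact: iet_gamma_bound|rewrite e ab].
suff : (iet_orbit T (gamma a) `&` iet_orbit T (gamma b)) (gamma b) by rewrite
  disj.
split; apply/iet_orbitE; split; try exact: iet_gamma_bound.
  by exists n.+1; left.
by exists 0%N; left.
Qed.

(** Otherwise the same letter [b] comes first in both orders. The second piece and the second image
    then both start at [l + len b], so one separation point is sent to a separation point in one
    step. *)
Lemma regular_origin c : iet_nonfirst T c ->
  exists2 a, iet_nonfirst T a & map (gamma a) = l.
Proof.
move=> nc; have lr : l <= l < r by have := iet_gamma_bound c; lra.
have [b bl] := iet_tau_cover lr; have [bin _] := iet_tau_inside b.
have {bl} bl : tau b = l by lra.
have [nb|nb] := pselect (iet_nonfirst T b).
  by exists b => //; rewrite iet_map_gamma.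
have {}nb : gamma b = l.
  by move: nb; rewrite iet_nonfirstP => /negP; have := iet_gamma_bound b; lra.
have bc : b != c by apply: contraPneq nc => <-; rewrite iet_nonfirstP nb ltxx.
have lenb := iet_len_gt0 T b.
have lbr : l <= l + len b < r.
  have := iet_gamma_inside c; have := iet_len_gt0 T c.
  by have := iet_gamma_apart bc; have := iet_gamma_bound c; rewrite nb; lra.
have [a al] := iet_cover lbr; have [e el] := iet_tau_cover lbr.
have ba : b != a by apply: contraTneq al => <-; rewrite iet_itvE nb; lra.
have be : b != e by apply: contraTneq el => <-; lra.
have ga : gamma a = l + len b.
  have := iet_gamma_apart ba; have := iet_gamma_bound a; move: al;
    rewrite iet_itvE nb.
  lra.
have te : tau e = l + len b.
  by have := iet_tau_apart be; have := iet_tau_inside e; lra.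
have na : iet_nonfirst T a by rewrite iet_nonfirstP ga; lra.
have ne : iet_nonfirst T e.
  rewrite iet_nonfirstP; have := iet_gamma_apart be; have := iet_gamma_bound e.
  by rewrite nb; lra.
by case: (regular_free (n := 0) ne na); rewrite /= iet_map_gamma te ga.
Qed.

Lemma regular_minimal c a b z : iet_nonfirst T c ->
  l <= a -> a < b -> b <= r -> l <= z < r -> exists n, a <= iter n map z < b.
Proof.
move=> /regular_origin[a0 na0 a0l].
apply: (@minimality _ l r map iet_cuts _ _ _ _ _ (gamma a0)) => //.
- exact: iet_map_dom.
- exact: iet_map_inj.
- exact: iet_map_surj.
- by move=> d /iet_cutsP[e /iet_nonfirstP ne ->]; have := iet_gamma_bound e;
  lra.
- move=> x y lx xy yr xyD; apply: iet_map_trans => // e ne.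
  by apply: xyD; apply/iet_cutsP; exists e.
- by apply/iet_cutsP; exists a0.
- move=> _ _ n /iet_cutsP[d nd ->] /iet_cutsP[e ne ->]; exact: regular_free.
Qed.

End Regular.
End Iet.

(** * Cylinders *)

Section Cylinders.
Variables (R : realType) (A : finType) (T : iet R A).
Local Notation l := (iet_left T).
Local Notation r := (iet_right T).
Local Notation len := (iet_len T).
Local Notation gamma := (iet_gamma T).
Local Notation map := (iet_map T).

Fixpoint cylinder (u : seq A) (z : R) : bool :=
  if u is a :: u' then (z \in iet_itv T a) && cylinder u' (map z) else true.

Lemma cyl_cat u v z : cylinder (u ++ v) z = cylinder u z && cylinder v (iter
  (size u) map z).
Proof. by elim: u z => //= a u IHu z; rewrite IHu andbA -iterS iterSr. Qed.

Lemma cyl_inj u v z : cylinder u z -> cylinder v z -> size u = size v -> u = v.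
Proof.
elim: u v z => [|a u IHu] [|b v] z //= /andP[za zu] /andP[zb zv] [uv].
by rewrite (iet_itv_inj za zb) (IHu v _ zu zv uv).
Qed.

Lemma cyl_word n z : l <= z < r -> exists2 u, size u = n & cylinder u z.
Proof.
elim: n z => [|n IHn] z zd; first by exists [::].
have [u un zu] := IHn _ (iet_map_dom zd); have [a za] := iet_cover zd.
by exists (a :: u); rewrite /= ?un ?za.
Qed.

Lemma cyl_coding u z :
  [seq Some a | a <- u] = mkseq (natural_coding T z) (size u) <-> cylinder u z.
Proof.
elim: u z => [|a u IHu] z //=.
rewrite /mkseq /= -[1%N]/(1 + 0)%N iotaDl -map_comp.
have -> : [seq (natural_coding T z \o addn 1) i | i <- iota 0 (size u)] =
    mkseq (natural_coding T (map z)) (size u).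
  by apply: eq_map => k; rewrite /comp /natural_coding add1n iterSr.
split=> [[/esym/iet_letterP za /IHu zu]|/andP[za zu]]; first exact/andP.
congr (_ :: _); last exact/IHu.
exact/esym/iet_letterP.
Qed.

Lemma cyl_translate u y z k : cylinder u y -> cylinder u z -> (k <= size u)%N ->
  iter k map y - iter k map z = y - z.
Proof.
elim: u y z k => [|a u IHu] y z [|k] //= /andP[ya yu] /andP[za zu] ku.
rewrite -!iterS !iterSr (IHu _ _ _ yu zu ku).
by rewrite (iet_mapE ya) (iet_mapE za); lra.
Qed.

(** At time [k] both points lie in the same piece, with the image of [p] strictly to the left, so
    [q] cannot be at a left endpoint. *)
Lemma cyl_gamma_left u p q k a : cylinder u p -> cylinder u q -> p < q ->
  (k < size u)%N -> iter k map q <> gamma a.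
Proof.
elim: u p q k => [|b u IHu] p q [|k] //= /andP[pb pu] /andP[qb qu] pq ku.
  move=> qa; have ab : a = b.
    by apply: iet_itv_inj qb; rewrite qa iet_gamma_itv.
  by move: pb; rewrite -ab iet_itvE; lra.
rewrite -iterS iterSr; apply: IHu pu qu _ ku.
by rewrite (iet_mapE pb) (iet_mapE qb); lra.
Qed.

(** A cylinder is a piece intersected with the translate of a shorter cylinder. Its left endpoint is
    the larger of the two left endpoints, which tells which separation point it runs into. *)
Lemma cyl_itv u z0 : l <= z0 < r -> cylinder u z0 -> exists x y,
  [/\ [/\ l <= x, x < y & y <= r],
      forall z, (x <= z < y) = (l <= z < r) && cylinder u z &
      x = l \/ exists k a, [/\ (k < size u)%N, iet_nonfirst T a &
        iter k map x = gamma a]].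
Proof.
elim: u z0 => [|a u IHu] z0 z0d /=.
  move=> _; exists l, r; split; [by split; lra| |by left].
  by move=> z; rewrite andbT.
move=> /andP[z0a z0u]; have [x [y [[lx xy yr] xyE xcut]]] :=
  IHu _ (iet_map_dom z0d) z0u.
pose c := gamma a - iet_tau T a.
have mapE z : z \in iet_itv T a -> map z = z - c.
  by move=> /iet_mapE ->; rewrite /c; lra.
have {}z0u : x <= z0 - c < y by rewrite -mapE // xyE iet_map_dom.
pose X := Num.max (gamma a) (x + c).
pose Y := Num.min (gamma a + len a) (y + c).
have XYE z : (X <= z < Y) = (z \in iet_itv T a) && (x + c <= z < y + c).
  by rewrite iet_itvE /X /Y ge_max lt_min; lra.
exists X, Y; split.
- have [la ar] := iet_gamma_inside T a; have XY : X <= z0 < Y.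
    by rewrite XYE z0a /=; lra.
  by split; move: XY; rewrite /X /Y ?le_max ?ge_min ?la ?ar //; lra.
- move=> z; rewrite XYE; have [za|_] /= := boolP (z \in iet_itv T a);
  last by rewrite andbF.
  have := xyE (map z); rewrite iet_map_dom ?(iet_itv_dom za) //= => <-.
  by rewrite (mapE _ za); lra.
have [xa|ax] := leP (x + c) (gamma a).
  have {xa}-> : X = gamma a by apply/max_idPl.
  have [->|] := eqVneq (gamma a) l; first by left.
  have := iet_gamma_bound T a => ga nl; right; exists 0%N, a; split=> //.
  by apply/iet_nonfirstP; move/eqP: nl; lra.
right; have XE : X = x + c by apply/max_idPr/ltW.
have Xa : X \in iet_itv T a.
  by move: z0a; rewrite XE !iet_itvE; lra.
have mX : map X = x by rewrite (mapE _ Xa) XE; lra.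
have [xl|[k [b [ku nb kb]]]] := xcut.
  (* The point [l] pulled back by the translation lies at or left of [gamma a], since every image
     starts at or after [l]. *)
  by have [tl _] := iet_tau_inside T a; move: ax; rewrite xl /c; lra.
by exists k.+1, b; split=> //; rewrite iterSr mX.
Qed.

Lemma cyl_recurrent u z0 z : iet_regular T -> l <= z0 < r -> cylinder u z0 ->
  l <= z < r -> exists n, cylinder u (iter n map z).
Proof.
move=> regT z0d z0u zd.
have [[c nc]|nn] := pselect (exists c, iet_nonfirst T c).
  have [x [y [[lx xy yr] xyE _]]] := cyl_itv z0d z0u.
  have [n] := regular_minimal regT nc lx xy yr zd.
  by rewrite xyE => /andP[_ ?]; exists n.
(* Without separation points there is a single letter, and every cylinder that is met contains the
   whole domain. *)
have gl a : gamma a = l.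
  have := iet_gamma_bound T a; have [//|] := eqVneq (gamma a) l => /eqP nl ga.
  by case: nn; exists a; apply/iet_nonfirstP; lra.
exists 0%N => /=; elim: u z0 z z0d z0u zd =>
  //= a u IHu z0 z z0d /andP[z0a z0u] zd.
have [b zb] := iet_cover zd.
rewrite (@iet_gamma_inj _ _ T a b) ?gl // zb /=.
by apply: IHu z0u _; exact: iet_map_dom.
Qed.

(** The base point disappears because every orbit enters every nonempty cylinder. *)
Lemma languageP u z : iet_regular T -> l <= z < r ->
  iet_language T z u <-> exists2 y, l <= y < r & cylinder u y.
Proof.
move=> regT zd; split=> [[n un]|[y yd yu]].
  exists (iter n map z); first exact: iet_iter_dom.
  apply/cyl_coding; rewrite un; apply: eq_map => k.
  by rewrite /natural_coding addnC iterD.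
have [n nu] := cyl_recurrent regT yd yu zd; exists n.
rewrite ((cyl_coding _ _).2 nu); apply: eq_map => k.
by rewrite /natural_coding addnC iterD.
Qed.

End Cylinders.

(** * The first return map to a cylinder *)

Section Induction.
Variables (R : realType) (A B : finType) (T : iet R A).
Variables (w : seq A) (f : seq B -> seq A).
Local Notation l := (iet_left T).
Local Notation r := (iet_right T).
Local Notation gamma := (iet_gamma T).
Local Notation map := (iet_map T).
Local Notation cyl := (cylinder T).
Local Notation F := [set u | exists2 y, l <= y < r & cyl u y].
Local Notation ret b := (f [:: b]).
Hypothesis regT : iet_regular T.
Hypothesis wF : F w.
Hypothesis fP : coding_morphism f (first_returns F w).

Lemma ret_right b : F (w ++ ret b) /\ exists2 v,
  v != [::] & v ++ w = w ++ ret b.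
Proof.
have [_ [/(_ b I)[[_ [Fwb [v vn [_ -> vE]]]] _] _ _]] := fP.
by split=> //; exists v.
Qed.

Lemma ret_size_gt0 b : (0 < size (ret b))%N.
Proof.
have [_ [v vn /(congr1 size)]] := ret_right b.
by rewrite !size_cat addnC => /addnI <-; rewrite lt0n size_eq0.
Qed.

Lemma ret_return b z : cyl (w ++ ret b) z -> cyl w (iter (size (ret b)) map z).
Proof.
have [_ [v vn vE]] := ret_right b; rewrite -vE cyl_cat => /andP[_].
by move: vE => /(congr1 size); rewrite !size_cat addnC => /addnI ->.
Qed.

Lemma right_return z x m : l <= z < r -> (0 < m)%N -> size x = m ->
  cyl (w ++ x) z -> cyl w (iter m map z) -> right_returns F w x.
Proof.
move=> zd m0 xm zwx mw; have := zwx; rewrite cyl_cat => /andP[zw zx].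
split; first by exists (iter (size w) map z); [exact: iet_iter_dom|].
split; first by exists z.
have zt : cyl (take m (w ++ x) ++ drop m (w ++ x)) z by rewrite cat_take_drop.
have mwx : (m <= size (w ++ x))%N by rewrite size_cat xm leq_addl.
exists (take m (w ++ x)).
  by rewrite /nonempty_words /= -size_eq0 size_takel // -lt0n.
exists w => //; rewrite -{2}(cat_take_drop m (w ++ x)); congr (_ ++ _).
move: zt; rewrite cyl_cat size_takel // => /andP[_].
by move/(cyl_inj mw); apply; rewrite size_drop size_cat xm addnK.
Qed.

(** An earlier return would make a proper prefix of the return word a return itself. *)
Lemma ret_first b z m : l <= z < r -> cyl (w ++ ret b) z ->
  (0 < m < size (ret b))%N -> ~~ cyl w (iter m map z).
Proof.
move=> zd zb /andP[m0 mb]; apply/negP => zm.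
have [_ [/(_ b I)[_ nret] _ _]] := fP; apply: nret.
exists (take m (ret b)).
  apply: (right_return zd m0 _ _ zm); first by rewrite size_take mb.
  by move: zb; rewrite -{1}(cat_take_drop m (ret b)) catA cyl_cat => /andP[].
exists (drop m (ret b)); last exact: cat_take_drop.
by rewrite /nonempty_words /= -size_eq0 size_drop subn_eq0 -ltnNge.
Qed.

(** The word has the first return time as its length, but it is read from time [size w] on, after
    the prefix [w]. *)
Lemma ret_exists z : l <= z < r -> cyl w z -> exists b, cyl (w ++ ret b) z.
Proof.
move=> zd zw; have [n0 n0w] := cyl_recurrent regT zd zw (iet_map_dom zd).
rewrite -iterSr in n0w.
have [|m /andP[m0 mw] mmin] :=
  @ex_minnP (fun n => (0 < n)%N && cyl w (iter n map z)).
  by exists n0.+1.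
have [x xm xz] := cyl_word m (iet_iter_dom (size w) zd).
have zwx : cyl (w ++ x) z by rewrite cyl_cat zw.
have [_ [_ _ /(_ x)[|b _ bx]]] := fP; last by exists b; rewrite bx.
split; first exact: right_return zwx mw.
move=> [x' [Fx' [Fwx' [v vn [_ -> vE]]]] [y yn xE]].
have sv : size v = size x'.
  by move: vE => /(congr1 size); rewrite !size_cat addnC => /addnI.
have yn' : (0 < size y)%N by rewrite lt0n size_eq0.
have vn' : (0 < size v)%N by rewrite lt0n size_eq0.
suff /mmin : (0 < size v)%N && cyl w (iter (size v) map z).
  by rewrite -xm -xE size_cat sv; lia.
rewrite vn' /=; move: zwx; rewrite -xE catA -vE cyl_cat cyl_cat.
by case/andP => /andP[].
Qed.

Lemma ret_uniq b c z : l <= z < r ->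
  cyl (w ++ ret b) z -> cyl (w ++ ret c) z -> b = c.
Proof.
move=> zd zb zc; have [_ [_ finj _]] := fP.
have neq d e : cyl (w ++ ret d) z -> cyl (w ++ ret e) z ->
    ~~ (size (ret d) < size (ret e))%N.
  move=> zd' ze; apply/negP => de.
  by have /negP[] := ret_first zd ze (introT andP (conj (ret_size_gt0 d) de));
     exact: ret_return.
apply: finj; rewrite ?inE //.
have /(cyl_inj zb)/(_ _)/eqP := zc; rewrite eqseq_cat // eqxx => e.
by apply/eqP/e; rewrite !size_cat; have := neq _ _ zb zc;
  have := neq _ _ zc zb; lia.
Qed.

(** Injectivity of the return map, across pieces: if the return times differed, the point with the
    shorter one would be an intermediate return of the other. *)
Lemma ret_merge b c y z : l <= y < r -> l <= z < r ->
  cyl (w ++ ret b) y -> cyl (w ++ ret c) z ->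
  iter (size (ret b)) map y = iter (size (ret c)) map z -> b = c.
Proof.
have wlogP d e y' z' : (size (ret d) <= size (ret e))%N ->
    l <= y' < r -> l <= z' < r -> cyl (w ++ ret d) y' -> cyl (w ++ ret e) z' ->
    iter (size (ret d)) map y' = iter (size (ret e)) map z' -> d = e.
  move=> de yd zd yb zc /(iet_iter_cancel de yd zd) yE.
  move: de; rewrite leq_eqVlt => /orP[/eqP de|de].
    by apply: (ret_uniq zd) => //; move: yE yb; rewrite de subnn => /= ->.
  have := ret_first zd zc (m := size (ret e) - size (ret d)).
  have := ret_size_gt0 d => d0;
    have -> : (0 < size (ret e) - size (ret d) < size (ret e))%N by lia.
  by move: yb; rewrite -yE cyl_cat => /andP[-> _] /(_ isT).
move=> yd zd yb zc e; have [bc|/ltnW cb] := leqP (size (ret b)) (size (ret c)).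
  exact: wlogP yb zc e.
exact/esym/(wlogP _ _ _ _ cb zd yd zc yb).
Qed.

(** An interface for the induced exchange: later results use these three facts and not its
    construction. *)
Definition first_return_iet (T' : iet R B) :=
  [/\ forall z, (iet_left T' <= z < iet_right T') = (l <= z < r) && cyl w z,
      forall b z, (z \in iet_itv T' b) = (l <= z < r) && cyl (w ++ ret b) z &
      forall b z, z \in iet_itv T' b ->
        iet_map T' z = iter (size (ret b)) map z].

Lemma first_return_iet_exists : exists T', first_return_iet T'.
Proof.
have [z0 z0d z0w] := wF.
have [al [be [[lal albe ber] wE _]]] := cyl_itv z0d z0w.
have /choice[g gP] : forall b, exists pq : R * R, pq.1 < pq.2 /\
    forall z, (pq.1 <= z < pq.2) = (l <= z < r) && cyl (w ++ ret b) z.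
  move=> b; have [[y yd yb] _] := ret_right b.
  by have [p [q [[_ pq _] pqE _]]] := cyl_itv yd yb; exists (p, q).
pose p b := (g b).1; pose len b := (g b).2 - p b.
have len_gt0 b : 0 < len b by have [] := gP b; rewrite /len /p; lra.
have pE b z : (p b <= z < p b + len b) = (l <= z < r) && cyl (w ++ ret b) z.
  by have [_ <-] := gP b; rewrite /len addrC subrK.
have pw b z : p b <= z < p b + len b -> al <= z < be.
  by rewrite pE wE cyl_cat => /and3P[-> ->].
have pp b : p b <= p b < p b + len b by have := len_gt0 b; lra.
pose t b := iter (size (ret b)) map (p b).
have tE b z : p b <= z < p b + len b ->
    iter (size (ret b)) map z = t b + (z - p b).
  move=> zb; have := pp b; move: zb; rewrite !pE => /andP[_ zb] /andP[_ pb].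
  by have := cyl_translate zb pb; move=> /(_ (size (ret b)));
    rewrite size_cat leq_addl => /(_ isT);
    rewrite /t; lra.
have tw b z : p b <= z < p b + len b -> al <= iter (size (ret b)) map z < be.
  by rewrite pE wE => /andP[zd /ret_return ->]; rewrite iet_iter_dom.
have p_apart b c : b != c -> p b <= p c -> p b + len b <= p c.
  move=> bc pbc; rewrite leNgt; apply/negP => cb; move/eqP: bc; apply.
  have : p b <= p c < p b + len b by rewrite pbc.
  by have := pp c; rewrite !pE => /andP[pd cc] /andP[_ cb'];
    exact: ret_uniq cb' cc.
(* If two images overlapped, a point of piece [b] would be sent to [t c], where the left endpoint of
   piece [c] also goes. *)
have t_apart b c : b != c -> t b <= t c -> t b + len b <= t c.
  move=> bc tbc; rewrite leNgt; apply/negP => cb; move/eqP: bc; apply.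
  have ub : p b <= p b + (t c - t b) < p b + len b by lra.
  have e : iter (size (ret b)) map (p b + (t c - t b)) = t c by rewrite tE //;
    lra.
  have := pp c; move: ub; rewrite !pE => /andP[ud ub] /andP[pd pc].
  exact: ret_merge ud pd ub pc e.
have p_inside b : al <= p b /\ p b + len b <= be.
  have := pw b _ (pp b); split; first lra.
  rewrite leNgt; apply/negP => beb; have := pw b be; lra.
have t_inside b : al <= t b /\ t b + len b <= be.
  have := tw b _ (pp b); rewrite -/(t b) => tb; split; first lra.
  rewrite leNgt; apply/negP => beb.
  have ub : p b <= p b + (be - t b) < p b + len b by lra.
  by have := tw b _ ub; rewrite (tE _ _ ub); lra.
have sum_len : \sum_b len b = be - al.
  apply: (tile_sum len_gt0 p_apart (ltW albe) p_inside) => z.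
  by rewrite wE => /andP[zd /(ret_exists zd)[b zb]]; exists b; rewrite pE zd.
have key_order (k : B -> R) : (forall b c, b != c -> k b <= k c ->
  k b + len b <= k c) ->
    total_order [rel b c | k b <= k c].
  move=> k_apart; split=> [b c|b c|b c d] /=;
    [exact: le_total| |exact: le_trans].
  move=> kbc; apply/eqP; apply: contraT => bc; have := k_apart _ _ bc.
  by have := len_gt0 b; lra.
have key_lt (k : B -> R) b c :
    (forall b c, b != c -> k b <= k c -> k b + len b <= k c) ->
    ((c != b) && (k c <= k b)) = (k c < k b).
  move=> k_apart; have [->|cb] := eqVneq c b; first by rewrite ltxx.
  by have := k_apart _ _ cb; have := len_gt0 c;
    case: (leP (k c) (k b)) => //; lra.
(* The two orders are read off the positions of the pieces and of their images. [tile_pos] then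
   gives these positions back as the endpoints computed from the lengths. *)
pose T' := IET al len_gt0 (key_order p p_apart) (key_order t t_apart).
have gE b : iet_gamma T' b = p b.
  rewrite (tile_pos len_gt0 p_apart p_inside sum_len b); congr (_ + _).
  by apply: eq_bigl => c; exact: key_lt.
have tauE b : iet_tau T' b = t b.
  rewrite /iet_tau /iet_nu sum_le_lt; last exact: iet_le2_order.
  rewrite addrA addrK (tile_pos len_gt0 t_apart t_inside sum_len b);
    congr (_ + _).
  by apply: eq_bigl => c; exact: key_lt.
exists T'; split=> [z|b z|b z].
- by rewrite -wE /iet_right /= sum_len addrC subrK.
- by rewrite iet_itvE gE pE.
move=> zb; rewrite (iet_mapE zb) gE tauE tE; first lra.
by move: zb; rewrite iet_itvE gE.
Qed.

(** * Separation points, regularity and language of the induced exchange *)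

Section FirstReturnIet.
Variable T' : iet R B.
Hypothesis T'P : first_return_iet T'.
Local Notation l' := (iet_left T').
Local Notation r' := (iet_right T').
Local Notation gamma' := (iet_gamma T').
Local Notation map' := (iet_map T').
Local Notation n := (size w).

Lemma first_return_dom z : l' <= z < r' -> l <= z < r /\ cyl w z.
Proof. by have [-> _ _] := T'P => /andP[]. Qed.

Lemma first_return_gamma b :
  l <= gamma' b < r /\ cyl (w ++ ret b) (gamma' b).
Proof. by have := iet_gamma_itv T' b; have [_ -> _] := T'P => /andP[]. Qed.

Lemma first_return_iter j z : l' <= z < r' ->
  exists2 t, (j <= t)%N & iter j map' z = iter t map z.
Proof.
move=> zd; elim: j => [|j [t jt tE]]; first by exists 0%N.
have [b zb] := iet_cover (iet_iter_dom j zd); have [_ _ mapE] := T'P.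
exists (size (ret b) + t)%N; first by have := ret_size_gt0 b; lia.
by rewrite iterS (mapE _ _ zb) iterD tE.
Qed.

(** [cyl_itv] provides the hit. It is not before time [size w], because [l'] lies to the left of
    [gamma' b] in the same cylinder of [w]. *)
Lemma cut_forward b : iet_nonfirst T' b -> exists a k,
  [/\ iet_nonfirst T a, (n <= k < n + size (ret b))%N &
      iter k map (gamma' b) = gamma a].
Proof.
move=> /iet_nonfirstP l'b; have [bd bw] := first_return_gamma b.
have [x [y [[lx xy yr] xyE xcut]]] := cyl_itv bd bw.
have xyitv z : (x <= z < y) = (z \in iet_itv T' b).
  by have [_ -> _] := T'P; rewrite xyE.
have xE : gamma' b = x.
  have := xyitv x; have := xyitv (gamma' b); rewrite iet_gamma_itv iet_itvE.
  by rewrite lexx xy => gb /esym; lra.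
have [|l'd l'w] := @first_return_dom l';
  first by have := iet_gamma_bound T' b; lra.
have [xl|[k [a [kw na kE]]]] := xcut; first by lra.
exists a, k; split; rewrite ?xE // -size_cat kw andbT leqNgt; apply/negP => kn.
move: bw; rewrite cyl_cat => /andP[bw _].
by apply: (cyl_gamma_left l'w bw l'b kn); rewrite xE kE.
Qed.

(** Both windows start at [n] and last one return time, so unequal hitting times would make one
    endpoint an intermediate return of the other. *)
Lemma cut_separate b c k m : (n <= k < n + size (ret b))%N ->
  (n <= m < n + size (ret c))%N ->
  iter k map (gamma' b) = iter m map (gamma' c) -> b = c.
Proof.
have wlogP d e i j : (i <= j)%N -> (n <= i)%N -> (j < n + size (ret e))%N ->
    iter i map (gamma' d) = iter j map (gamma' e) -> d = e.
  move=> ij ni je; have [dd dw] := first_return_gamma d.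
  have [ed ew] := first_return_gamma e => /(iet_iter_cancel ij dd ed) dE.
  move: ij; rewrite leq_eqVlt => /orP[/eqP ij|ij].
    by apply: (ret_uniq dd) => //; rewrite dE ij subnn.
  have := ret_first ed ew (m := j - i);
    have -> : (0 < j - i < size (ret e))%N by lia.
  by move: dw; rewrite -dE cyl_cat => /andP[-> _] /(_ isT).
move=> /andP[nk kb] /andP[nm mc] e.
have [km|/ltnW mk] := leqP k m; first exact: wlogP e.
exact/esym/(wlogP _ _ m k).
Qed.

Lemma cut_backward a : iet_nonfirst T a -> exists b k,
  [/\ iet_nonfirst T' b, (n <= k)%N & iter k map (gamma' b) = gamma a].
Proof.
move=> na; have ad := iet_gamma_bound T a; have [domE itvE mapE] := T'P.
have [z0 z0d z0w] := wF; have [m ma] := cyl_recurrent regT z0d z0w ad.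
have md : l' <= iter m map (gamma a) < r' by rewrite domE iet_iter_dom.
have back j : exists2 q, l' <= q < r' & iter j map' q = iter m map (gamma a).
  elim: j => [|j [q qd qj]]; first by exists (iter m map (gamma a)).
  (* From a visit of [gamma a] to the cylinder at time [m], one goes back [n + m] returns. This
     takes at least [n + m] steps of [map], hence reaches a point at least [n] steps before
     [gamma a]. *)
  by have [q' q'd q'q] := iet_map_surj qd; exists q'; rewrite // iterSr q'q.
have [q0 q0d q0E] := back (n + m)%N;
  have [t nmt] := first_return_iter (n + m) q0d.
rewrite q0E => /esym tE.
pose hit k := (n <= k)%N && `[< exists2 q,
  l' <= q < r' & iter k map q = gamma a >].
have [|k /andP[nk /asboolP[q qd qk]] kmin] := @ex_minnP hit.
  have mt : (m <= t)%N := leq_trans (leq_addl n m) nmt.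
  exists (t - m)%N; apply/andP; split; first by rewrite leq_subRL // addnC.
  apply/asboolP; exists q0 => //; apply/esym.
  have [q0d' _] := first_return_dom q0d.
  exact: (iet_iter_cancel mt ad q0d' (esym tE)).
have [qd' qw] := first_return_dom qd; have [b qb] := iet_cover qd.
(* Otherwise [map' q] would be a hit with a smaller [k]. *)
have kb : (k < n + size (ret b))%N.
  rewrite ltnNge; apply/negP => bk; suff /kmin : hit (k - size (ret b))%N.
    have k0 : (0 < k)%N by apply: leq_trans bk;
      rewrite addn_gt0 ret_size_gt0 orbT.
    by rewrite leqNgt ltn_subrL ret_size_gt0 k0.
  apply/andP; split; first by rewrite leq_subRL ?(leq_trans _ bk) ?leq_addl //
    addnC.
  apply/asboolP; exists (map' q); first exact: iet_map_dom.
  by rewrite (mapE _ _ qb) -iterD subnK // (leq_trans _ bk) ?leq_addl.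
(* If [q] were [l'], it would be [l], the image of a separation point, or run into one before time
   [n]. Either way a separation point would reach [gamma a]. *)
have l'q : l' < q.
  have [||] := ltgtP l' q => //; first by lra.
  move=> l'q; have [a0 na0 a0l] := regular_origin regT na.
  have [x [y [[lx xy yr] xyE xcut]]] := cyl_itv qd' qw.
  have xq : x = q.
    have xx : x <= x < y by lra.
    have := domE x; rewrite -xyE xx => x'd.
    by have := xyE q; rewrite qd' qw; lra.
  case: xcut => [xl|[j [c [jn nc jc]]]].
    by case: (regular_free (n := k) regT na0 na); rewrite iterSr a0l -xl xq.
  have kj : k = ((k - j).-1.+1 + j)%N.
    have jk := leq_trans jn nk; by rewrite prednK ?subn_gt0 // subnK // ltnW.
  case: (regular_free (n := (k - j).-1) regT nc na).
  by rewrite -jc xq -iterD -kj.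
suff qE : gamma' b = q.
  by exists b, k; split; rewrite ?qE //; apply/iet_nonfirstP; rewrite qE.
have [gd gw] := first_return_gamma b.
have := qb; rewrite itvE => /andP[_ qbw].
have := qb; rewrite iet_itvE => /andP[bq _]; apply/eqP; rewrite eq_le bq leNgt.
apply/negP => bq'; apply: (cyl_gamma_left gw qbw bq' _ qk).
by rewrite size_cat.
Qed.

(** Injections both ways between separation points: [cut_separate] gives the first. For the second,
    one endpoint meeting two separation points would link them by an orbit. *)
Lemma first_return_card : #|B| = #|A|.
Proof.
have [domE _ _] := T'P; have [z0 z0d z0w] := wF.
have [a0 _] := iet_cover z0d.
have [b0 _] : exists b, z0 \in iet_itv T' b.
  by apply: iet_cover; rewrite domE z0d.
rewrite (iet_card T' b0) (iet_card T a0); congr _.+1; apply/eqP;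
  rewrite eqn_leq.
apply/andP; split.
  have /choice[psi psiP] : forall b, exists a, iet_nonfirst T' b ->
    iet_nonfirst T a /\
      exists2 k, (n <= k < n + size (ret b))%N & iter k map (gamma' b) = gamma
        a.
    move=> b; have [nb|nb] := pselect (iet_nonfirst T' b); last by exists a0.
    by have [a [k [na nk e]]] := cut_forward nb; exists a => _; split=> //;
      exists k.
  apply: (@card_le_inj_in _ _ _ _ psi) =>
    [b /iet_nonfirstP/psiP[/iet_nonfirstP //]|].
  move=> b c /iet_nonfirstP/psiP[_ [k nk kE]] /iet_nonfirstP/psiP[_ [m nm mE]]
    bc.
  by apply: cut_separate nk nm _; rewrite kE mE bc.
have /choice[phi phiP] : forall a, exists b, iet_nonfirst T a ->
  iet_nonfirst T' b /\
    exists k, iter k map (gamma' b) = gamma a.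
  move=> a; have [na|na] := pselect (iet_nonfirst T a); last by exists b0.
  by have [b [k [nb nk e]]] := cut_backward na; exists b => _; split=> //;
    exists k.
apply: (@card_le_inj_in _ _ _ _ phi) =>
  [a /iet_nonfirstP/phiP[/iet_nonfirstP //]|].
move=> a c /iet_nonfirstP na /iet_nonfirstP nc ac.
have [_ [k kE]] := phiP a na; have [_ [m mE]] := phiP c nc.
have inj d e i j : iet_nonfirst T d -> iet_nonfirst T e -> (i <= j)%N ->
    iter i map (gamma' (phi a)) = gamma d ->
      iter j map (gamma' (phi a)) = gamma e -> d = e.
  move=> nd ne ij iE; rewrite -(subnK ij) iterD iE.
  by case: (j - i)%N => [/iet_gamma_inj//|h /(regular_free regT nd ne)].
rewrite -ac in mE; have [km|/ltnW mk] := leqP k m; first exact: inj kE mE.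
exact/esym/(inj c a m k).
Qed.

Lemma first_return_orbit b y : iet_orbit T' (gamma' b) y ->
  forall a k, iter k map (gamma' b) = gamma a -> iet_orbit T (gamma a) y.
Proof.
move=> /iet_orbitE[yd' [j jE]] a k kE; have [yd _] := first_return_dom yd'.
have gd' := iet_gamma_bound T' b; have [gd _] := first_return_gamma b.
apply/iet_orbitE; split=> //; case: jE => e.
  have [t _] := first_return_iter j gd'; rewrite -e => {}e.
  have [kt|/ltnW tk] := leqP k t.
    by exists (t - k)%N; left; rewrite -kE -iterD subnK.
  by exists (k - t)%N; right; rewrite -kE e -iterD subnK.
have [t _] := first_return_iter j yd'; rewrite -e => {}e.
by exists (k + t)%N; right; rewrite -kE e iterD.
Qed.

Lemma first_return_regular : iet_regular T'.
Proof.
split=> [b nb|b c nb nc bc].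
  have gd' := iet_gamma_bound T' b; have [a [k [na _ kE]]] := cut_forward nb.
  have [gd _] := first_return_gamma b.
  (* A repetition would make [gamma' b] periodic under [map], and with it the separation point
     [gamma a] on its orbit. *)
  have neq i j : (i < j)%N -> iter i map' (gamma' b) <> iter j map' (gamma' b).
    move=> ij; rewrite -(subnK (ltnW ij)) iterD.
    have id' := iet_iter_dom i gd';
      have [t jt ->] := first_return_iter (j - i) id'.
    have [s _ ->] := first_return_iter i gd'.
    have t0 : (0 < t)%N by apply: leq_trans jt; rewrite subn_gt0.
    rewrite -(prednK t0) -iterD addnC iterD =>
      /(iet_iter_inj gd (iet_iter_dom _ gd)) e.
    apply: (regular_free (n := t.-1) regT na na).
    by rewrite -kE -iterD addnC iterD -e.
  move=> /(@finite_preimage _ _ _ (fun j => iter j map' (gamma' b))).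
  rewrite [X in finite_set X](_ : _ = [set: nat]).
    move=> fin; apply: infinite_nat; apply: fin => i j _ _ e;
      apply: contrapT => ij.
    by case: (ltngtP i j) => // /neq; rewrite e.
  apply/predeqP => j; split=> // _; apply/iet_orbitE; split;
    first exact: iet_iter_dom.
  by exists j; left.
rewrite -subset0 => y [/first_return_orbit yb /first_return_orbit yc].
have [a [k [na nk kE]]] := cut_forward nb.
have [d [m [nd nm mE]]] := cut_forward nc.
have ad : a != d by apply: contra_neq bc => ad; apply: cut_separate nk nm _;
  rewrite kE mE ad.
have [_ disj] := regT; rewrite -(disj a d na nd ad).
by split; [exact: yb kE|exact: yc mE].
Qed.

(** Decoding commutes with inducing: after the first letter [b] the orbit is back in the cylinder of
    [w], which restores the prefix [w] for the remaining letters. *)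
Lemma first_return_cyl u z : l' <= z < r' -> cylinder T' u z = cyl (w ++ f u) z.
Proof.
have [[f0 fD] _] := fP; have [domE itvE mapE] := T'P.
elim: u z => [|b u IHu] z zd'; have [zd zw] := first_return_dom zd'.
  by rewrite f0 cats0 zw.
rewrite /= -(cat1s b u) fD catA [in RHS]cyl_cat itvE zd /=.
have [zb|] := boolP (cyl (w ++ ret b) z) => //=.
have zb' : z \in iet_itv T' b by rewrite itvE zd.
rewrite IHu ?iet_map_dom // (mapE _ _ zb') cyl_cat (ret_return zb) /=.
by rewrite -iterD size_cat.
Qed.

Lemma first_return_language z : l' <= z < r' ->
  derived_set f F w = iet_language T' z.
Proof.
move=> zd; apply/predeqP => u; rewrite (languageP u first_return_regular zd).
have [domE _ _] := T'P; split=> [[y yd yu]|[y yd yu]].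
  have yd' : l' <= y < r' by move: yu; rewrite domE yd cyl_cat => /andP[].
  by exists y => //; rewrite first_return_cyl.
by exists y; [case: (first_return_dom yd)|rewrite -first_return_cyl].
Qed.

End FirstReturnIet.
End Induction.

Unset Implicit Arguments.

(* F(T) is the set of factors of the coding of T at z, for any point z of the
   domain.  Independence of the base point is not presupposed: z is arbitrary,
   and the derived set must be the set of factors of the coding of T' at every
   point of its domain. *)
Theorem theorem3p19 (R : realType) (s : nat) (A B : finType) (T : iet R A)
    (z : R) (F : set (seq A)) (w : seq A) (f : seq B -> seq A)
    (cardA : #|A| = s)
    (regT : iet_regular T)
    (zT : z \in iet_dom T)
    (FT : F = iet_language T z)
    (wF : F w)
    (fP : coding_morphism f (first_returns F w)) :
  #|B| = s /\
  exists T' : iet R B, iet_regular T' /\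
    forall z' : R, z' \in iet_dom T' -> derived_set f F w = iet_language T' z'.
Proof.
rewrite iet_domE in zT.
have FE : F = [set u | exists2 y, iet_left T <= y < iet_right T & cylinder T u y].
  by rewrite FT; apply/predeqP => u; exact: languageP.
rewrite FE in wF fP *; have [T' T'P] := first_return_iet_exists regT wF fP.
split; first by rewrite (first_return_card regT wF fP T'P).
exists T'; split; first exact: (first_return_regular regT fP T'P).
move=> z'; rewrite iet_domE; exact: (first_return_language regT fP T'P).
Qed.
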